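(* Let $(\mathcal{M},H,J)$ be an almost CR manifold of dimension $2m+1$. Suppose that it admits a nowhere vanishing density $\sigma\in\Gamma(\mathcal{E}(1,0))$ satisfying the system of CR invariant differential equations (i) $\nabla_{\bar\alpha}\sigma=0$; (ii) $\nabla_{(\alpha}\nabla_{\beta)}\sigma+i\,\mathsf A_{\alpha\beta}\sigma+\tfrac1m\nabla^\gamma\mathsf N_{\gamma(\alpha\beta)}\,\sigma=0$; (iii) $\nabla_\gamma\sigma\,\mathsf N^\gamma{}_{(\bar\alpha\bar\beta)}-\tfrac1m\nabla_\gamma\mathsf N^\gamma{}_{(\bar\alpha\bar\beta)}\,\sigma=0$; (iv) $\big(2\,\mathsf N_{\alpha\gamma\delta}\mathsf N_{\bar\beta}{}^{\gamma\delta}-\mathsf N_{\gamma\delta\alpha}\mathsf N^{\gamma\delta}{}_{\bar\beta}\big)_\circ=0$. Then $s:=\sigma\bar\sigma$ is a CR--Einstein scale. Conversely, suppose that $s$ is a CR--Einstein scale, and that $s=\sigma\bar\sigma$ for some $\sigma\in\Gamma(\mathcal E(1,0))$ satisfying (i). Then $\sigma$ also satisfies (ii), (iii) and (iv).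
   Context: An almost CR manifold $(\mathcal{M},H,J)$ is an oriented smooth manifold of dimension $2m+1$ ($m\ge1$) with a rank-$2m$ contact distribution $H$ and a complex structure $J$ on the bundle $H$ that is partially integrable: $[H^{(1,0)},H^{(1,0)}]\subset{}^{\mathbb C}H$, where ${}^{\mathbb C}H=H^{(1,0)}\oplus H^{(0,1)}$ are the $\pm i$-eigenbundles of $J$. $\mathrm{Ann}(H)$ is oriented; a pseudo-Hermitian structure is a positive contact form $\theta\in\Gamma(\mathrm{Ann}(H))$. The canonical bundle $\mathcal C=\bigwedge^{m+1}\mathrm{Ann}(H^{(0,1)})$ is assumed to admit a $-(m+2)$-nd root $\mathcal E(1,0)$, and $\mathcal E(w,w')=\mathcal E(1,0)^{w}\otimes\overline{\mathcal E(1,0)}{}^{w'}$ for $w-w'\in\mathbb Z$. There are canonical nowhere vanishing sections $\boldsymbol\theta$ of $T^*\mathcal M\otimes\mathcal E(1,1)$ and $\boldsymbol h_{\alpha\bar\beta}$ of $(H^{(1,0)})^*\otimes(H^{(0,1)})^*\otimes\mathcal E(1,1)$ (weighted Levi form) such that every CR scale, i.e. every real-valued $0<s\in\Gamma(\mathcal E(1,1))$, gives a pseudo-Hermitian structure $\theta=s^{-1}\boldsymbol\theta$ with Levi form $h=s^{-1}\boldsymbol h$. Indices $\alpha,\beta,\dots$ refer to $H^{(1,0)}$ and $\bar\alpha,\bar\beta,\dots$ to $H^{(0,1)}$; they are raised and lowered with $\boldsymbol h_{\alpha\bar\beta}$; round (square) brackets denote (skew-)symmetrisation; $(\cdot)_\circ$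 is the trace-free part with respect to $\boldsymbol h$. Webster connection: given $\theta$, let $\ell$ be its Reeb field ($\theta(\ell)=1$, $d\theta(\ell,\cdot)=0$), and let $(\theta,\theta^\alpha,\bar\theta^{\bar\alpha})$ be an adapted coframe (dual to a frame $(\ell,e_\alpha,\bar e_{\bar\alpha})$ with $e_\alpha\in H^{(1,0)}$). The Webster connection $\nabla$ is the unique connection preserving $\theta$ and $d\theta$, with $\nabla\theta^\alpha=-\Gamma_\beta{}^\alpha\otimes\theta^\beta$, and $$d\theta=i h_{\alpha\bar\beta}\theta^\alpha\wedge\bar\theta^{\bar\beta},\qquad d\theta^\alpha=\theta^\beta\wedge\Gamma_\beta{}^\alpha+\mathsf A^\alpha{}_{\bar\beta}\theta\wedge\bar\theta^{\bar\beta}-\tfrac12\mathsf N_{\bar\beta\bar\gamma}{}^\alpha\bar\theta^{\bar\beta}\wedge\bar\theta^{\bar\gamma},$$ where the Webster torsion satisfies $\mathsf A_{\alpha\beta}=\mathsf A_{(\alpha\beta)}$ and the Nijenhuis tensor satisfies $\mathsf N_{\alpha\beta\gamma}=\mathsf N_{[\alpha\beta]\gamma}$, $\mathsf N_{[\alpha\beta\gamma]}=0$. $\nabla$ extends to the density bundles through $\mathcal C=\mathcal E(-m-2,0)$ (if $\sigma^{-(m+2)}=\theta\wedge\theta^1\wedge\dots\wedge\theta^m$, then $\nabla\sigma=\frac1{m+2}\Gamma_\alpha{}^\alpha\sigma$), and preserves $\boldsymbol\theta$ and the CR scale of $\theta$. Its curvature is $\mathsf R_{\alpha\bar\beta\delta}{}^\gamma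 v^\delta=(\nabla_\alpha\nabla_{\bar\beta}-\nabla_{\bar\beta}\nabla_\alpha)v^\gamma+i\boldsymbol h_{\alpha\bar\beta}\nabla_0v^\gamma$ ($\nabla_0$ being the derivative along the weighted Reeb field), with $\mathsf{Ric}_\gamma{}^\delta=\boldsymbol h^{\alpha\bar\beta}\mathsf R_{\alpha\bar\beta\gamma}{}^\delta$, $\mathsf{Sc}=\mathsf{Ric}_\gamma{}^\gamma$, and $\mathsf P_{\alpha\bar\beta}=\frac1{m+2}\big(\mathsf{Ric}_{\alpha\bar\beta}-\frac1{2m+2}\mathsf{Sc}\,\boldsymbol h_{\alpha\bar\beta}\big)$. Equations are taken with respect to the Webster connection of any pseudo-Hermitian structure (the systems are CR invariant). A CR--Einstein scale is a CR scale $s$ satisfying $\nabla_{(\alpha}\nabla_{\beta)}s+i\mathsf A_{\alpha\beta}s+\mathsf N_{\gamma(\alpha\beta)}\nabla^\gamma s=0$, $\nabla^\gamma s\,\mathsf N_{\gamma(\alpha\beta)}-\frac1m\nabla^\gamma\mathsf N_{\gamma(\alpha\beta)}s=0$, and $\big(s\nabla_{\bar\beta}\nabla_\alpha s-\nabla_\alpha s\nabla_{\bar\beta}s+\mathsf P_{\alpha\bar\beta}s^2-\frac1{m+2}\mathsf N_{\alpha\gamma\delta}\mathsf N_{\bar\beta}{}^{\gamma\delta}s^2\big)_\circ=0$. *)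

(* Defs.v *)
From HB Require Import structures.
From mathcomp Require Import all_boot all_order all_algebra.
From mathcomp Require Import complex.
From mathcomp Require Import all_classical all_reals all_analysis.

Set Implicit Arguments.
Unset Strict Implicit.
Unset Printing Implicit Defensive.

Import Order.TTheory GRing.Theory Num.Theory.
Import numFieldNormedType.Exports.

Local Open Scope classical_set_scope.
Local Open Scope ring_scope.
Local Open Scope complex_scope.

(* [O] is meant to be open.  Existence and continuity of all directional
   derivatives up to order [k] is the usual notion of class C^k. *)
Fixpoint Ck (R : realType) (n k : nat) (O : set 'rV[R]_n)
    (g : 'rV[R]_n -> R^o) : Prop :=
  (forall x, O x -> {for x, continuous g}) /\
  match k with
  | 0 => True
  | k'.+1 => forall v : 'rV[R]_n,
      (forall x, O x -> derivable g x v) /\ Ck k' O (fun x => 'D_v g x)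
  end.

Definition Cinf (R : realType) (n : nat) (O : set 'rV[R]_n)
    (g : 'rV[R]_n -> R^o) : Prop := forall k, Ck k O g.

Record chart (R : realType) (n : nat) (M : Type) := Chart {
  cdom : set M;
  cmap : M -> 'rV[R]_n;
  cinv : 'rV[R]_n -> M }.

Definition is_chart (R : realType) (n : nat) (M : topologicalType)
    (c : chart R n M) : Prop :=
  [/\ open (cdom c), open (cmap c @` cdom c),
      forall x, cdom c x -> cinv c (cmap c x) = x,
      forall x, cdom c x -> {for x, continuous (cmap c)} &
      forall x, cdom c x -> {for cmap c x, continuous (cinv c)}].

Record manifold (R : realType) (n : nat) := Manifold {
  mcarrier :> topologicalType;
  atlas : set (chart R n mcarrier);
  mfd_hausdorff : hausdorff_space mcarrier;
  mfd_countable : @second_countable mcarrier;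
  atlas_chart : forall c, atlas c -> is_chart c;
  atlas_cover : forall x, exists2 c, atlas c & cdom c x;
  atlas_smooth : forall c d, atlas c -> atlas d -> forall j,
    Cinf (cmap c @` (cdom c `&` cdom d))
         (fun u => cmap d (cinv c u) ord0 j);
  atlas_oriented : forall c d, atlas c -> atlas d ->
    forall x, cdom c x -> cdom d x ->
    0 < \det (jacobian (fun u => cmap d (cinv c u)) (cmap c x)) }.

Section Calculus.
Context (R : realType) (n : nat) (M : manifold R n).
Implicit Types (x : M) (U V : set M) (f g : M -> R[i]).

Definition smooth_on U f : Prop := forall c, atlas c ->
  Cinf (cmap c @` (U `&` cdom c)) (fun u => complex.Re (f (cinv c u))) /\
  Cinf (cmap c @` (U `&` cdom c)) (fun u => complex.Im (f (cinv c u))).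

Definition smooth_at x f : Prop :=
  exists U, [/\ open U, U x & smooth_on U f].

(* Complexified tangent vectors at [x] are the C-linear derivations of the
   algebra of germs at [x] of complex-valued smooth functions.  They are
   extended by 0 to the other functions, so that equality of tangent vectors
   is equality of functionals. *)
Definition functional := (M -> R[i]) -> R[i].
Implicit Types (v w : functional).

Definition tangent x v : Prop :=
  [/\ forall f, ~ smooth_at x f -> v f = 0,
      forall f g, (\forall y \near x, f y = g y) -> v f = v g,
      forall (a : R[i]) f g, smooth_at x f -> smooth_at x g ->
        v (fun y => a * f y + g y) = a * v f + v g &
      forall f g, smooth_at x f -> smooth_at x g ->
        v (fun y => f y * g y) = v f * g x + f x * v g].

Definition tlin (a : R[i]) v w : functional := fun f => a * v f + w f.

Definition tsum (I : finType) (a : I -> R[i]) (v : I -> functional)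
  : functional := fun f => \sum_i a i * v i f.

Definition tconj v : functional := fun f => (v (fun y => (f y)^*))^*.

Definition treal v : Prop := tconj v = v.

Definition vecfield := M -> functional.

Definition vfield U (X : vecfield) : Prop := forall x, U x ->
  tangent x (X x) /\
  forall f, smooth_at x f -> smooth_at x (fun y => X y f).

Definition fconj (X : vecfield) : vecfield := fun x => tconj (X x).

Definition bracket (X Y : vecfield) : vecfield := fun x f =>
  if `[< smooth_at x f >] then
    X x (fun y => Y y f) - Y x (fun y => X y f)
  else 0.

(* Complex-valued 1-forms; only their values on [tangent] functionals
   are meaningful. *)
Definition covector := M -> functional -> R[i].
Implicit Types (a b : covector).

Definition one_form U a : Prop :=
  (forall x, U x -> forall (c : R[i]) v w, tangent x v -> tangent x w ->
     a x (tlin c v w) = c * a x v + a x w) /\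
  (forall V X, open V -> V `<=` U -> vfield V X ->
     forall x, V x -> smooth_at x (fun y => a y (X y))).

Definition form_conj a : covector := fun x v => (a x (tconj v))^*.

Definition dform a (X Y : vecfield) : M -> R[i] := fun x =>
  X x (fun y => a y (Y y)) - Y x (fun y => a y (X y)) - a x (bracket X Y x).

Definition wedge a b (X Y : vecfield) : M -> R[i] := fun x =>
  a x (X x) * b x (Y x) - a x (Y x) * b x (X x).

Definition coords (c : chart R n M) v : 'rV[R]_n :=
  \row_j complex.Re (v (fun y => (cmap c y ord0 j)%:C)).

End Calculus.

Section Distribution.
Context (R : realType) (n : nat) (M : manifold R n).
Context (H : M -> set (functional M)) (J : M -> functional M -> functional M).

Definition CH (x : M) : set (functional M) := [set v |
  exists u w, [/\ H x u, H x w & v = tlin 'i w u]].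

(* The eigenspaces of the C-linear extension of [J] to the complexification
   of [H]: the eigenvector is u + iw, its image is Ju + iJw. *)
Definition Jeigen (lam : R[i]) (x : M) : set (functional M) := [set v |
  exists u w, [/\ H x u, H x w, v = tlin 'i w u &
    tlin 'i (J x w) (J x u) = (fun f => lam * v f)]].

Definition H10 := Jeigen 'i.
Definition H01 := Jeigen (- 'i).

Definition section_of (D : M -> set (functional M)) (U : set M)
    (X : vecfield M) : Prop := vfield U X /\ forall x, U x -> D x (X x).

End Distribution.

Record almostCR (R : realType) (m : nat) := AlmostCR {
  base :> manifold R (m.*2.+1);
  Hdist : base -> set (functional base);
  Jcr : base -> functional base -> functional base;
  H_tangent : forall x v, Hdist x v -> tangent x v /\ treal v;
  H_rank : forall x, exists U (X : 'I_m.*2 -> vecfield base),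
    [/\ open U, U x, forall i, vfield U (X i) &
      forall y, U y ->
        (forall v, Hdist y v <-> exists c : 'I_m.*2 -> R,
           v = tsum (fun i => (c i)%:C) (fun i => X i y)) /\
        (forall c : 'I_m.*2 -> R,
           (forall f, tsum (fun i => (c i)%:C) (fun i => X i y) f = 0) ->
           forall i, c i = 0)];
  J_stable : forall x v, Hdist x v -> Hdist x (Jcr x v);
  J_linear : forall x (c : R) v w, Hdist x v -> Hdist x w ->
    Jcr x (tlin c%:C v w) = tlin c%:C (Jcr x v) (Jcr x w);
  J_square : forall x v, Hdist x v -> Jcr x (Jcr x v) = (fun f => - v f);
  J_smooth : forall U X, open U -> section_of Hdist U X ->
    vfield U (fun x => Jcr x (X x));
  (* contact: the tensorial map (X, Y) |-> [X, Y] mod H is nondegenerate *)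
  H_contact : forall x v, Hdist x v -> v <> (fun _ => 0) ->
    exists U X Y, [/\ open U, U x, section_of Hdist U X,
      section_of Hdist U Y & X x = v /\ ~ Hdist x (bracket X Y x)];
  J_partially_integrable : forall U X Y, open U ->
    section_of (H10 Hdist Jcr) U X -> section_of (H10 Hdist Jcr) U Y ->
    forall x, U x -> CH Hdist x (bracket X Y x) }.

Section PseudoHermitian.
Context (R : realType) (m : nat) (M : almostCR R m).

(* The family (T, u 0, J (u 0), ..., u (m-1), J (u (m-1))). *)
Definition Jframe (x : M) (T : functional M) (u : nat -> functional M)
    (k : nat) : functional M :=
  match k with
  | 0 => T
  | j.+1 => if odd j then Jcr x (u j./2) else u j./2
  end.

(* The orientations of M and of H (by J) induce the one of Ann(H). *)
Definition positive_form (theta : covector M) : Prop :=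
  forall x c T u, atlas c -> cdom c x -> tangent x T -> treal T ->
    (forall k, (k < m)%N -> Hdist x (u k)) ->
    0 < \det (\matrix_(k < m.*2.+1, j < m.*2.+1)
                coords c (Jframe x T u k) ord0 j) ->
    0 < theta x T.

Record pseudo_hermitian (theta : covector M) : Prop := PseudoHermitian {
  ph_form : one_form [set: M] theta;
  ph_real : forall x v, tangent x v -> theta x (tconj v) = (theta x v)^*;
  ph_ker : forall x v, tangent x v -> treal v ->
    (theta x v = 0 <-> Hdist x v);
  ph_positive : positive_form theta }.

End PseudoHermitian.

Section Canonical.
Context (R : realType) (m : nat) (M : almostCR R m).

(* (m+1)-covectors at [x] annihilated by insertion of (0,1)-vectors. *)
Definition canonical_form (x : M)
    (z : ('I_m.+1 -> functional M) -> R[i]) : Prop :=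
  [/\ forall (w : 'I_m.+1 -> functional M) i (c : R[i]) u v,
        (forall j, tangent x (w j)) -> tangent x u -> tangent x v ->
        z (fun j => if j == i then tlin c u v else w j) =
        c * z (fun j => if j == i then u else w j) +
        z (fun j => if j == i then v else w j),
      forall w i j, (forall k, tangent x (w k)) ->
        i != j -> w i = w j -> z w = 0 &
      forall w i, (forall k, tangent x (w k)) ->
        H01 (@Hdist _ _ M) (@Jcr _ _ M) x (w i) -> z w = 0].

(* E(1,0): a complex line bundle given by its fibres and a set of local
   trivialising sections with smooth transition functions, with a smooth
   fibrewise map t |-> t^{-(m+2)}, homogeneous of degree -(m+2) and nonzero
   off 0, into the canonical bundle; that is, an isomorphism of
   E(1,0)^{-(m+2)} with the canonical bundle. *)
Record canonical_root := CanonicalRoot {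
  fibre : M -> lmodType R[i];
  fibre_line : forall x, exists2 t : fibre x, t <> 0 &
    forall u : fibre x, exists c : R[i], u = c *: t;
  trivs : set (set M * (forall x, fibre x));
  trivs_open : forall U t, trivs (U, t) -> open U;
  trivs_neq0 : forall U t, trivs (U, t) -> forall x, U x -> t x <> 0;
  trivs_cover : forall x, exists U t, trivs (U, t) /\ U x;
  trivs_smooth : forall U t V t', trivs (U, t) -> trivs (V, t') ->
    exists g : M -> R[i], forall x, U x -> V x ->
      t x = g x *: t' x /\ smooth_at x g;
  can : forall x, fibre x -> ('I_m.+1 -> functional M) -> R[i];
  can_form : forall x (t : fibre x), t <> 0 -> canonical_form x (can t);
  can_neq0 : forall x (t : fibre x), t <> 0 ->
    exists2 w, (forall j, tangent x (w j)) & can t w <> 0;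
  can_homog : forall x (t : fibre x) (c : R[i]) w, t <> 0 -> c <> 0 ->
    (forall j, tangent x (w j)) ->
    can (c *: t) w = (c ^+ (m + 2))^-1 * can t w;
  can_smooth : forall U t (X : 'I_m.+1 -> vecfield M) V, trivs (U, t) ->
    open V -> V `<=` U -> (forall j, vfield V (X j)) ->
    forall x, V x -> smooth_at x (fun y => can (t y) (fun j => X j y)) }.

Context (E : canonical_root).

Definition smooth_frame (U : set M) (t : forall x, fibre E x) : Prop :=
  (forall x, U x -> t x <> 0) /\
  forall V t', trivs (V, t') -> exists g : M -> R[i], forall x,
    U x -> V x -> t x = g x *: t' x /\ smooth_at x g.

(* An element of E(w,w')_x, the fibre of E(1,0)^w (x) conj(E(1,0))^w', is
   represented by its coordinate with respect to the basis
   t^w (x) conj(t)^w', as a function of the basis t of E(1,0)_x.  The value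
   at t = 0 is irrelevant. *)
Definition density := forall x, fibre E x -> R[i].

Definition density_of (w w' : int) (s : density) : Prop :=
  (forall x (t : fibre E x) (c : R[i]), t <> 0 -> c <> 0 ->
     s x (c *: t) = c ^ (- w) * (c^*) ^ (- w') * s x t) /\
  (forall U t, open U -> smooth_frame U t ->
     forall x, U x -> smooth_at x (fun y => s y (t y))).

Definition nowhere_vanishing (s : density) : Prop :=
  forall x (t : fibre E x), t <> 0 -> s x t <> 0.

Definition sqnorm (s : density) : density := fun x t => s x t * (s x t)^*.

Definition density_eq (s s' : density) : Prop :=
  forall x (t : fibre E x), t <> 0 -> s x t = s' x t.

(* In the order of R[i], 0 < z means that z is real and positive. *)
Definition CR_scale (s : density) : Prop :=
  density_of 1 1 s /\ forall x (t : fibre E x), t <> 0 -> 0 < s x t.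

End Canonical.

(* The frame (l, e_a, conj e_a) over [wdom], its dual coframe
   (theta, th_a, conj th_a), the data of the structure equations:
     levi a b    = h_{a bar b}
     gam b a     = Gamma_b^a
     tors a b    = A^a_{bar b}
     nij b c a   = N_{bar b bar c}^a
   and a section [wtriv] of E(1,0) whose power -(m+2) is
   theta /\ th_1 /\ ... /\ th_m. *)
Record webster (R : realType) (m : nat) (M : almostCR R m)
    (E : canonical_root M) (theta : covector M) := Webster {
  wdom : set M;
  reeb : vecfield M;
  fr : 'I_m -> vecfield M;
  cofr : 'I_m -> covector M;
  levi : M -> 'M[R[i]]_m;
  gam : 'I_m -> 'I_m -> covector M;
  tors : 'I_m -> 'I_m -> M -> R[i];
  nij : 'I_m -> 'I_m -> 'I_m -> M -> R[i];
  wtriv : forall x, fibre E x;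
  wdom_open : open wdom;
  reeb_field : vfield wdom reeb;
  reeb_real : forall x, wdom x -> treal (reeb x);
  reeb_theta : forall x, wdom x -> theta x (reeb x) = 1;
  reeb_dtheta : forall V Y, open V -> V `<=` wdom -> vfield V Y ->
    forall x, V x -> dform theta reeb Y x = 0;
  fr_section : forall a, section_of (H10 (@Hdist _ _ M) (@Jcr _ _ M)) wdom (fr a);
  cofr_form : forall a, one_form wdom (cofr a);
  cofr_reeb : forall a x, wdom x -> cofr a x (reeb x) = 0;
  cofr_fr : forall a b x, wdom x -> cofr a x (fr b x) = (a == b)%:R;
  cofr_frb : forall a b x, wdom x -> cofr a x (fconj (fr b) x) = 0;
  frame_span : forall x v, wdom x -> tangent x v -> forall f,
    v f = theta x v * reeb x f + \sum_a cofr a x v * fr a x f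
          + \sum_a form_conj (cofr a) x v * fconj (fr a) x f;
  levi_smooth : forall a b x, wdom x -> smooth_at x (fun y => levi y a b);
  gam_form : forall b a, one_form wdom (gam b a);
  tors_smooth : forall a b x, wdom x -> smooth_at x (tors a b);
  nij_smooth : forall b c a x, wdom x -> smooth_at x (nij b c a);
  eq_dtheta : forall V X Y, open V -> V `<=` wdom ->
    vfield V X -> vfield V Y -> forall x, V x ->
    dform theta X Y x = 'i * \sum_a \sum_b
      levi x a b * wedge (cofr a) (form_conj (cofr b)) X Y x;
  eq_dcofr : forall a V X Y, open V -> V `<=` wdom ->
    vfield V X -> vfield V Y -> forall x, V x ->
    dform (cofr a) X Y x =
      \sum_b wedge (cofr b) (gam b a) X Y x
      + \sum_b tors a b x * wedge theta (form_conj (cofr b)) X Y x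
      - 2%:R^-1 * \sum_b \sum_c nij b c a x *
          wedge (form_conj (cofr b)) (form_conj (cofr c)) X Y x;
  (* the connection preserves dtheta *)
  levi_parallel : forall a b x v, wdom x -> tangent x v ->
    v (fun y => levi y a b) = \sum_c gam a c x v * levi x c b
                              + \sum_c form_conj (gam b c) x v * levi x a c;
  (* A_{[bar a bar b]} = 0, N_{(bar a bar b)}^c = 0,
     N_{[bar a bar b bar c]} = 0 *)
  tors_sym : forall a b x, wdom x ->
    \sum_d tors d b x * levi x d a = \sum_d tors d a x * levi x d b;
  nij_skew : forall a b c x, wdom x -> nij a b c x = - nij b a c x;
  nij_cyclic : forall a b c x, wdom x ->
    \sum_d (nij a b d x * levi x d c + nij b c d x * levi x d a
            + nij c a d x * levi x d b) = 0;
  wtriv_frame : smooth_frame wdom wtriv;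
  wtriv_vol : forall x w, wdom x -> (forall j, tangent x (w j)) ->
    can (wtriv x) w =
      \det (\matrix_(i < m.+1, j < m.+1)
              (if unlift ord0 i is Some a then cofr a x (w j)
               else theta x (w j))) }.

Section WebsterCalculus.
Context (R : realType) (m : nat) (M : almostCR R m) (E : canonical_root M).
Context (theta : covector M) (F : webster E theta).
Implicit Types (X : vecfield M) (s : density E) (x : M).

Local Notation C := R[i].
Local Notation e := (fr F).
Local Notation eb := (fun a => fconj (fr F a)).
Local Notation Gam := (gam F).
Local Notation Gamb := (fun b a => form_conj (gam F b a)).

(* Weighted tensors are represented by their components in the frame and
   in the trivialisation [wtriv]. *)

Definition comp s : M -> C := fun x => s x (wtriv F x).

(* The component of the CR scale s with theta = s^{-1} bold-theta, where
   bold-theta is normalised so that theta is volume-normalised with respect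
   to theta /\ th_1 /\ ... /\ th_m iff |det h| = 1. *)
Definition scale_comp : M -> C := fun x =>
  ((ComplexField.Normc.normc (\det (levi F x))) `^ (- (m.+2)%:R^-1))%:C.

Definition blevi x : 'M[C]_m := scale_comp x *: levi F x.

(* [blevi_inv x c b] is h^{c bar b}, with h_{a bar b} h^{c bar b} = delta *)
Definition blevi_inv x (c b : 'I_m) : C := invmx (blevi x) b c.

(* A_{ab}, of weight 0: the weight (-1,-1) of A^a_{bar b} relative to
   bold-theta cancels the weight of the form used to lower the index. *)
Definition A_low (a b : 'I_m) : M -> C := fun x =>
  (\sum_d tors F d b x * levi F x d a)^*.

(* N_{bar a bar b bar c} and N_{abc}, of weight (1,1) *)
Definition Nb_low (a b c : 'I_m) : M -> C := fun x =>
  \sum_d nij F a b d x * blevi x d c.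
Definition N_low (a b c : 'I_m) : M -> C := fun x => (Nb_low a b c x)^*.

(* The connection form of E(w,w'): 1/(m+2) Gamma_a^a on E(1,0). *)
Definition dconn (w w' : int) : covector M := fun x v =>
  (m.+2)%:R^-1 * (w%:~R * \sum_a Gam a a x v + w'%:~R * \sum_a Gamb a a x v).

Definition nab0 (w w' : int) X (f : M -> C) : M -> C := fun x =>
  X x f + dconn w w' x (X x) * f x.

(* T_a, the index being unbarred *)
Definition nab1 (w w' : int) X (T : 'I_m -> M -> C) (a : 'I_m) : M -> C :=
  fun x => nab0 w w' X (T a) x - \sum_d Gam a d x (X x) * T d x.

(* T_{abc}, all indices of one type, with G = Gam or Gamb accordingly *)
Definition nab3 (G : 'I_m -> 'I_m -> covector M) (w w' : int) X
    (T : 'I_m -> 'I_m -> 'I_m -> M -> C) (a b c : 'I_m) : M -> C := fun x =>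
  nab0 w w' X (T a b c) x
  - \sum_d (G a d x (X x) * T d b c x + G b d x (X x) * T a d c x
            + G c d x (X x) * T a b d x).

(* v^c *)
Definition nabv X (v : 'I_m -> M -> C) (c : 'I_m) : M -> C := fun x =>
  X x (v c) + \sum_d Gam d c x (X x) * v d x.

(* V_a^c, the lower index being unbarred or barred as G = Gam or Gamb *)
Definition nabm (G : 'I_m -> 'I_m -> covector M) X
    (V : 'I_m -> 'I_m -> M -> C) (a c : 'I_m) : M -> C := fun x =>
  nabv X (V a) c x - \sum_d G a d x (X x) * V d c x.

(* The weighted Reeb field is s^{-1} times that of theta, s = [scale_comp]. *)
Definition nab_reeb (v : 'I_m -> M -> C) (c : 'I_m) : M -> C := fun x =>
  (scale_comp x)^-1 * nabv (reeb F) v c x.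

Definition curv_op (a b : 'I_m) (v : 'I_m -> M -> C) (c : 'I_m) : M -> C :=
  fun x =>
    nabm Gamb (e a) (fun b' => nabv (eb b') v) b c x
    - nabm Gam (eb b) (fun a' => nabv (e a') v) a c x
    + 'i * blevi x a b * nab_reeb v c x.

(* R_{a bar b d}^c: [curv_op] is tensorial in v; it is evaluated at e_d. *)
Definition curv (a b d c : 'I_m) : M -> C :=
  curv_op a b (fun k _ => (k == d)%:R) c.

Definition Ric_mix (c d : 'I_m) : M -> C := fun x =>
  \sum_a \sum_b blevi_inv x a b * curv a b c d x.
Definition Ric (a b : 'I_m) : M -> C := fun x =>
  \sum_d Ric_mix a d x * blevi x d b.
Definition Sc : M -> C := fun x => \sum_c Ric_mix c c x.
Definition Pten (a b : 'I_m) : M -> C := fun x =>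
  (m.+2)%:R^-1 * (Ric a b x - (m.*2.+2)%:R^-1 * Sc x * blevi x a b).

Definition sym2 (T : 'I_m -> 'I_m -> M -> C) (a b : 'I_m) : M -> C := fun x =>
  2%:R^-1 * (T a b x + T b a x).

Definition tracefree (T : 'I_m -> 'I_m -> M -> C) (a b : 'I_m) : M -> C :=
  fun x => T a b x
    - m%:R^-1 * (\sum_c \sum_d blevi_inv x c d * T c d x) * blevi x a b.

(* nabla^c N_{cab} and nabla_c N^c_{bar a bar b} *)
Definition divN (a b : 'I_m) : M -> C := fun x =>
  \sum_c \sum_d blevi_inv x c d * nab3 Gam 1 1 (eb d) N_low c a b x.
Definition divNb (a b : 'I_m) : M -> C := fun x =>
  \sum_c \sum_d blevi_inv x c d * nab3 Gamb 1 1 (e c) Nb_low d a b x.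

(* nabla^c s N_{cab}, for s of weight (1,1), and
   nabla_c sigma N^c_{bar a bar b}, for sigma of weight (1,0) *)
Definition gradN s (a b : 'I_m) : M -> C := fun x =>
  \sum_c \sum_d blevi_inv x c d * nab0 1 1 (eb d) (comp s) x * N_low c a b x.
Definition gradNb s (a b : 'I_m) : M -> C := fun x =>
  \sum_c \sum_d blevi_inv x c d * nab0 1 0 (e c) (comp s) x * Nb_low d a b x.

(* N_{acd} N_{bar b}^{cd} and N_{cda} N^{cd}_{bar b} *)
Definition NN1 (a b : 'I_m) : M -> C := fun x =>
  \sum_c \sum_d \sum_c' \sum_d' blevi_inv x c c' * blevi_inv x d d'
    * N_low a c d x * Nb_low b c' d' x.
Definition NN2 (a b : 'I_m) : M -> C := fun x =>
  \sum_c \sum_d \sum_c' \sum_d' blevi_inv x c c' * blevi_inv x d d'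
    * N_low c d a x * Nb_low c' d' b x.

Definition hess (w w' : int) s (a b : 'I_m) : M -> C :=
  nab1 w w' (e a) (fun b' => nab0 w w' (e b') (comp s)) b.

(* nabla_{bar b} nabla_a s; as nabla preserves types, nab1 applies *)
Definition hessb (w w' : int) s (b a : 'I_m) : M -> C :=
  nab1 w w' (eb b) (fun a' => nab0 w w' (e a') (comp s)) a.

Definition eqn_i s : Prop := forall a x, wdom F x ->
  nab0 1 0 (eb a) (comp s) x = 0.

Definition eqn_ii s : Prop := forall a b x, wdom F x ->
  sym2 (hess 1 0 s) a b x + 'i * A_low a b x * comp s x
  + m%:R^-1 * sym2 divN a b x * comp s x = 0.

Definition eqn_iii s : Prop := forall a b x, wdom F x ->
  sym2 (gradNb s) a b x - m%:R^-1 * sym2 divNb a b x * comp s x = 0.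

Definition eqn_iv : Prop := forall a b x, wdom F x ->
  tracefree (fun a b x => 2%:R * NN1 a b x - NN2 a b x) a b x = 0.

Definition eqn_E1 s : Prop := forall a b x, wdom F x ->
  sym2 (hess 1 1 s) a b x + 'i * A_low a b x * comp s x
  + sym2 (gradN s) a b x = 0.

Definition eqn_E2 s : Prop := forall a b x, wdom F x ->
  sym2 (gradN s) a b x - m%:R^-1 * sym2 divN a b x * comp s x = 0.

Definition eqn_E3 s : Prop := forall a b x, wdom F x ->
  tracefree (fun a b x =>
      comp s x * hessb 1 1 s b a x
      - nab0 1 1 (e a) (comp s) x * nab0 1 1 (eb b) (comp s) x
      + Pten a b x * comp s x ^+ 2
      - (m.+2)%:R^-1 * NN1 a b x * comp s x ^+ 2) a b x = 0.

End WebsterCalculus.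

(* The systems, with respect to the Webster connection of theta; being
   local, they are imposed in all adapted coframes. *)
Section Systems.
Context (R : realType) (m : nat) (M : almostCR R m) (E : canonical_root M).
Context (theta : covector M).

Definition system_i (s : density E) : Prop :=
  forall F : webster E theta, eqn_i F s.
Definition system_ii (s : density E) : Prop :=
  forall F : webster E theta, eqn_ii F s.
Definition system_iii (s : density E) : Prop :=
  forall F : webster E theta, eqn_iii F s.
Definition system_iv : Prop :=
  forall F : webster E theta, eqn_iv F.

Definition CR_Einstein_scale (s : density E) : Prop :=
  CR_scale s /\
  forall F : webster E theta, [/\ eqn_E1 F s, eqn_E2 F s & eqn_E3 F s].

End Systems.

(* Main.v *)
Require Import Defs.
From mathcomp Require Import all_boot all_order all_algebra.
From mathcomp Require Import complex.
From mathcomp Require Import all_classical all_reals all_analysis.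
From mathcomp Require Import ring.

(** Let f be the component of sigma in an adapted frame, so that s has component
f f^*.  By (i) and its conjugate, the covariant derivatives of s along
H^(1,0) are those of sigma times f^*.  The divergence of N and its
contraction with the gradient of s are conjugate to the barred ones, up to the
factor f ([gradN_norm], [divN_conj]).  Hence the second equation of a
CR-Einstein scale is f times the conjugate of (iii) ([eqn_E2_iff]) and, modulo
the second, the first is f^* times (ii) ([eqn_E1_iff]).

The third equation is where curvature enters.  Since the barred derivative of
sigma vanishes, its mixed second derivative is a commutator, that is, the
curvature of E(1,0) applied to sigma plus a multiple of the Levi form
([hessb_holomorphic]); that curvature is 1/(m+2) times the trace
Q_(a bar b) = R_(a bar b c)^c.  The Schouten tensor contains the other trace
Ric_(a bar b) of the same curvature tensor, and the two differ because the
almost CR structure need not be integrable: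
    Q_(a bar b) = Ric_(a bar b) + N_(acd) N_(bar b)^(cd)
                                - N_(cda) N^(cd)_(bar b)
([curvature_trace]).  With this substitution Ric cancels, and what is left of
the third equation is - s^2/(m+2) times (iv).

The difference of the traces comes from moving the indices of R in two steps.
The first Bianchi identity exchanges the two unbarred indices up to a term
quadratic in N; it is the component along H^(1,0) of the Jacobi identity for
the fields e_a, e_d, bar e_b ([bianchi]).  The compatibility of the connection
with the Levi form turns this into an exchange of the two barred indices
([curvature_herm]).  Taking the trace requires an invertible Levi matrix, which
is what the contact condition provides ([levi_unit]). *)

Set Implicit Arguments.
Unset Strict Implicit.
Unset Printing Implicit Defensive.
Import Order.TTheory GRing.Theory Num.Theory.
Import numFieldNormedType.Exports.
Local Open Scope classical_set_scope.
Local Open Scope ring_scope.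
Local Open Scope complex_scope.

Lemma conjM (R : rcfType) (x y : R[i]) : conjc (x * y) = conjc x * conjc y.
Proof. exact: rmorphM. Qed.

Lemma conjD (R : rcfType) (x y : R[i]) : conjc (x + y) = conjc x + conjc y.
Proof. exact: rmorphD. Qed.

Lemma conjB (R : rcfType) (x y : R[i]) : conjc (x - y) = conjc x - conjc y.
Proof. exact: rmorphB. Qed.

Lemma conj_sum (R : rcfType) (I : finType) (G : I -> R[i]) :
  conjc (\sum_i G i) = \sum_i conjc (G i).
Proof. exact: rmorph_sum. Qed.

Lemma sum_delta (R : pzRingType) (I : finType) (i : I) (f : I -> R) :
  \sum_j (j == i)%:R * f j = f i.
Proof.
rewrite (bigD1 i) //= eqxx mul1r big1 ?addr0 // => j /negPf ->.
by rewrite mul0r.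
Qed.

Lemma sum_delta_sym (R : pzRingType) (I : finType) (i : I) (f : I -> R) :
  \sum_j (i == j)%:R * f j = f i.
Proof. by rewrite -[RHS]sum_delta; apply: eq_bigr => j _; rewrite eq_sym. Qed.

(** * Smooth functions *)

Section SmoothReal.
Context (R : realType) (n : nat).
Implicit Types (O : set 'rV[R]_n) (f g : 'rV[R]_n -> R^o).

Lemma Ck_subset k O O' g : O' `<=` O -> Ck k O g -> Ck k O' g.
Proof.
move=> sub; elim: k g => [|k IH] g /= [cg dg]; split=> //.
- by move=> x /sub; exact: cg.
- by move=> x /sub; exact: cg.
- move=> v; have [d1 d2] := dg v; split; first by move=> x /sub; exact: d1.
  exact: IH d2.
Qed.

Lemma Ck_pred k O g : Ck k.+1 O g -> Ck k O g.
Proof.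
elim: k g => [|k IH] g [cg dg]; split=> // v.
by have [d1 d2] := dg v; split=> //; exact: IH.
Qed.

(** Openness is what makes the directional derivatives of [f] and [g] agree as well. *)
Lemma Ck_eq k O f g : open O -> (forall x, O x -> f x = g x) ->
  Ck k O f -> Ck k O g.
Proof.
move=> oO; elim: k f g => [|k IH] f g fg [cf df].
all: have nfg x : O x -> \forall y \near x, f y = g y
  by move=> Ox; apply: filterS (open_nbhs_nbhs (conj oO Ox)) => y; exact: fg.
all: have cg x : O x -> {for x, continuous g}
  by move=> Ox; rewrite /prop_for /continuous_at -(fg _ Ox);
     apply: cvg_trans (cf x Ox); exact: near_eq_cvg (nfg x Ox).
- by split.
- split=> // v; have [d1 d2] := df v; split=> [x Ox|].
    exact: near_eq_derivable (nfg x Ox) (d1 x Ox).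
  by apply: IH d2 => x Ox; apply: near_eq_derive; exact: nfg.
Qed.

Lemma Ck_cst k O (a : R) : Ck k O (fun=> a).
Proof.
elim: k a => [|k IH] a; split=> //.
- by move=> x _; exact: cst_continuous.
- by move=> x _; exact: cst_continuous.
- move=> v; split=> [x _|]; first exact: (derivable_cst (a : R^o)).
  have -> : (fun x => 'D_v (fun=> a : R^o) x) = (fun=> 0) :> ('rV[R]_n -> R^o).
    by apply/funext => x; exact: (derive_cst (a : R^o)).
  exact: IH.
Qed.

Lemma Ck_add k O f g : open O -> Ck k O f -> Ck k O g ->
  Ck k O (fun x => f x + g x).
Proof.
move=> oO; elim: k f g => [|k IH] f g [cf df] [cg dg]; split=> //.
- by move=> x Ox; exact: continuousD (cf x Ox) (cg x Ox).
- by move=> x Ox; exact: continuousD (cf x Ox) (cg x Ox).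
- move=> v; have [df1 df2] := df v; have [dg1 dg2] := dg v; split=> [x Ox|].
    exact: derivableD (df1 x Ox) (dg1 x Ox).
  apply: (Ck_eq oO _ (IH _ _ df2 dg2)) => x Ox.
  by rewrite -(deriveD (df1 x Ox) (dg1 x Ox)).
Qed.

(** By the Leibniz rule the derivatives of a product are again sums of products;
the induction therefore also uses that both factors are of class [C^(k-1)]
([Ck_pred]). *)
Lemma Ck_mul k O f g : open O -> Ck k O f -> Ck k O g ->
  Ck k O (fun x => f x * g x : R).
Proof.
move=> oO; elim: k f g => [|k IH] f g Cf Cg.
  by case: Cf Cg => [cf _] [cg _]; split=> // x Ox;
     exact: continuousM (cf x Ox) (cg x Ox).
have [[cf df] [cg dg]] := (Cf, Cg); split.
  by move=> x Ox; exact: continuousM (cf x Ox) (cg x Ox).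
move=> v; have [df1 df2] := df v; have [dg1 dg2] := dg v; split=> [x Ox|].
  exact: derivableM (df1 x Ox) (dg1 x Ox).
apply: (Ck_eq oO _ (Ck_add oO (IH _ _ (Ck_pred Cf) dg2)
                              (IH _ _ (Ck_pred Cg) df2))) => x Ox.
by rewrite -(deriveM (df1 x Ox) (dg1 x Ox)).
Qed.

End SmoothReal.

Section SmoothFunctions.
Context (R : realType) (n : nat) (M : manifold R n).
Implicit Types (x : M) (U V : set M) (f g : M -> R[i]).

(** Near a point of the image, the inverse chart is continuous and takes its
values in [U]. *)
Lemma chart_image_open (c : chart R n M) U : atlas c -> open U ->
  open (cmap c @` (U `&` cdom c)).
Proof.
move=> /atlas_chart [od oi ck _ ci] oU; rewrite openE => _ [x [Ux dx] <-].
have nI : nbhs (cmap c x) (cmap c @` cdom c).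
  by apply: open_nbhs_nbhs; split=> //; exists x.
have nU : \forall u \near cmap c x, U (cinv c u).
  by apply: (ci x dx); rewrite ck //; exact: open_nbhs_nbhs.
rewrite /interior; apply: filterS2 nI nU => _ [y dy <-].
by rewrite ck // => Uy; exists y.
Qed.

Lemma smooth_on_subset U V f : V `<=` U -> smooth_on U f -> smooth_on V f.
Proof.
move=> VU sf c ac; have [s1 s2] := sf c ac.
have sub : cmap c @` (V `&` cdom c) `<=` cmap c @` (U `&` cdom c).
  by move=> _ [y [Vy dy] <-]; exists y => //; split=> //; exact: VU.
by split=> k; apply: Ck_subset sub _.
Qed.

Lemma smooth_on_eq U f g : open U -> (forall x, U x -> f x = g x) ->
  smooth_on U f -> smooth_on U g.
Proof.
move=> oU fg sf c ac; have [s1 s2] := sf c ac.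
have [_ _ ck _ _] := atlas_chart ac.
split=> k; [have := s1 k|have := s2 k]; apply: Ck_eq.
- exact: chart_image_open.
- by move=> _ [y [Uy dy] <-]; rewrite ck // fg.
- exact: chart_image_open.
- by move=> _ [y [Uy dy] <-]; rewrite ck // fg.
Qed.

Lemma smooth_at_near x f g : (\forall y \near x, f y = g y) ->
  smooth_at x f -> smooth_at x g.
Proof.
move=> fg [U [oU Ux sf]]; move: fg; rewrite /prop_near1 nbhsE => -[V [oV Vx] fg].
have oW : open (U `&` V) by exact: openI.
exists (U `&` V); split=> //; apply: (@smooth_on_eq _ f) => //.
  by move=> y [_ /fg].
by apply: smooth_on_subset sf => y [].
Qed.

Lemma smooth_near x f : smooth_at x f -> \forall y \near x, smooth_at y f.
Proof.
case=> U [oU Ux sf]; apply: filterS (open_nbhs_nbhs (conj oU Ux)) => y Uy.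
by exists U.
Qed.

Lemma smooth_cst x (a : R[i]) : smooth_at x (fun=> a).
Proof.
exists setT; split=> //; first exact: openT.
by move=> c ac; split=> k; exact: Ck_cst.
Qed.

Lemma smooth_at_op x f g (op : R[i] -> R[i] -> R[i]) :
  (forall U, open U -> smooth_on U f -> smooth_on U g ->
     smooth_on U (fun y => op (f y) (g y))) ->
  smooth_at x f -> smooth_at x g -> smooth_at x (fun y => op (f y) (g y)).
Proof.
move=> H [U [oU Ux sf]] [V [oV Vx sg]]; exists (U `&` V); split=> //.
  exact: openI.
apply: H; first exact: openI.
  by apply: smooth_on_subset sf => y [].
by apply: smooth_on_subset sg => y [].
Qed.

Lemma smoothD x f g : smooth_at x f -> smooth_at x g ->
  smooth_at x (fun y => f y + g y).
Proof.
apply: smooth_at_op => U oU sf sg c ac.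
have [f1 f2] := sf c ac; have [g1 g2] := sg c ac.
have oO := chart_image_open ac oU.
split=> k.
  apply: (Ck_eq oO _ (Ck_add oO (f1 k) (g1 k))) => u _.
  by case: (f _) (g _) => [a b] [].
apply: (Ck_eq oO _ (Ck_add oO (f2 k) (g2 k))) => u _.
by case: (f _) (g _) => [a b] [].
Qed.

Lemma smoothM x f g : smooth_at x f -> smooth_at x g ->
  smooth_at x (fun y => f y * g y).
Proof.
apply: smooth_at_op => U oU sf sg c ac.
have [f1 f2] := sf c ac; have [g1 g2] := sg c ac.
have oO := chart_image_open ac oU.
split=> k.
  apply: (Ck_eq oO _ (Ck_add oO (Ck_mul oO (f1 k) (g1 k))
    (Ck_mul oO (Ck_cst k _ (-1)) (Ck_mul oO (f2 k) (g2 k))))) => u _.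
  by case: (f _) (g _) => [a b] [c' d] /=; rewrite mulN1r.
apply: (Ck_eq oO _ (Ck_add oO (Ck_mul oO (f1 k) (g2 k))
    (Ck_mul oO (f2 k) (g1 k)))) => u _.
by case: (f _) (g _) => [a b] [c' d] /=.
Qed.

Lemma smooth_conj x f : smooth_at x f -> smooth_at x (fun y => (f y)^*).
Proof.
case=> U [oU Ux sf]; exists U; split=> // c ac; have [f1 f2] := sf c ac.
have oO := chart_image_open ac oU.
split=> k.
  by apply: (Ck_eq oO _ (f1 k)) => u _; case: (f _).
apply: (Ck_eq oO _ (Ck_mul oO (Ck_cst k _ (-1)) (f2 k))) => u _.
by case: (f _) => [a b] /=; rewrite mulN1r.
Qed.

Lemma smooth_conjE x f : smooth_at x (fun y => (f y)^*) <-> smooth_at x f.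
Proof.
split=> [/smooth_conj|]; last exact: smooth_conj.
by congr smooth_at; apply/funext => y; rewrite conjcK.
Qed.

Lemma smoothN x f : smooth_at x f -> smooth_at x (fun y => - f y).
Proof.
move=> /(smoothM (smooth_cst x (-1))).
by congr smooth_at; apply/funext => y; rewrite mulN1r.
Qed.

Lemma smoothB x f g : smooth_at x f -> smooth_at x g ->
  smooth_at x (fun y => f y - g y).
Proof. by move=> sf sg; apply: smoothD sf (smoothN sg). Qed.

Lemma smooth_sum (I : Type) (r : seq I) x (F : I -> M -> R[i]) :
  (forall i, smooth_at x (F i)) -> smooth_at x (fun y => \sum_(i <- r) F i y).
Proof.
move=> sF; elim: r => [|i r IH].
  have -> : (fun y => \sum_(i <- [::]) F i y) = (fun=> 0).
    by apply/funext => y; rewrite big_nil.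
  exact: smooth_cst.
have -> : (fun y => \sum_(j <- i :: r) F j y)
        = (fun y => F i y + \sum_(j <- r) F j y).
  by apply/funext => y; rewrite big_cons.
exact: smoothD.
Qed.

End SmoothFunctions.

(** * Complex tangent vectors, brackets and one-forms *)

Section TangentVectors.
Context (R : realType) (n : nat) (M : manifold R n).
Implicit Types (x : M) (U V : set M) (f g : M -> R[i]) (v w : functional M)
  (X Y Z : vecfield M).

Lemma near_open U x (P : M -> Prop) : open U -> U x ->
  (forall y, U y -> P y) -> \forall y \near x, P y.
Proof. by move=> oU Ux UP; apply: filterS (open_nbhs_nbhs (conj oU Ux)). Qed.

Lemma tan_near x v f g : tangent x v -> (\forall y \near x, f y = g y) ->
  v f = v g.
Proof. by case=> _ H _ _; exact: H. Qed.

Lemma tan_eq_on U x v f g : tangent x v -> open U -> U x ->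
  (forall y, U y -> f y = g y) -> v f = v g.
Proof. by move=> tv oU Ux fg; apply: (tan_near tv); exact: near_open fg. Qed.

Lemma tan_cst x v a : tangent x v -> v (fun=> a) = 0.
Proof.
case=> _ _ lin leib; have s b := smooth_cst x b.
have v0 : v (fun=> 0) = 0.
  have := lin 1 _ _ (s 0) (s 0); rewrite mulr0 addr0 mul1r.
  by move=> H; apply: (addrI (v (fun=> 0))); rewrite addr0; exact/esym.
have v1 : v (fun=> 1) = 0.
  have := leib _ _ (s 1) (s 1); rewrite !mulr1 mul1r.
  by move=> H; apply: (addrI (v (fun=> 1))); rewrite addr0; exact/esym.
by have := lin a _ _ (s 1) (s 0); rewrite v0 v1 mulr0 mulr1 !addr0.
Qed.

Lemma tan_lin x v a f g : tangent x v -> smooth_at x f -> smooth_at x g ->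
  v (fun y => a * f y + g y) = a * v f + v g.
Proof. by case=> _ _ H _; exact: H. Qed.

Lemma tanD x v f g : tangent x v -> smooth_at x f -> smooth_at x g ->
  v (fun y => f y + g y) = v f + v g.
Proof.
case=> _ _ lin _ sf sg; have := lin 1 _ _ sf sg; rewrite mul1r => <-.
by congr v; apply/funext => y; rewrite mul1r.
Qed.

Lemma tanM x v f g : tangent x v -> smooth_at x f -> smooth_at x g ->
  v (fun y => f y * g y) = v f * g x + f x * v g.
Proof. by case=> _ _ _; exact. Qed.

Lemma tanZ x v a f : tangent x v -> smooth_at x f ->
  v (fun y => a * f y) = a * v f.
Proof.
by move=> tv sf; rewrite (tanM tv (smooth_cst x a) sf) (tan_cst a tv) mul0r add0r.
Qed.

Lemma tanN x v f : tangent x v -> smooth_at x f -> v (fun y => - f y) = - v f.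
Proof.
move=> tv sf; rewrite -[RHS]mulN1r -(tanZ _ tv sf).
by congr v; apply/funext => y; rewrite mulN1r.
Qed.

Lemma tanB x v f g : tangent x v -> smooth_at x f -> smooth_at x g ->
  v (fun y => f y - g y) = v f - v g.
Proof. by move=> tv sf sg; rewrite (tanD tv sf (smoothN sg)) (tanN tv sg). Qed.

Lemma tan_sum (I : Type) (r : seq I) x v (F : I -> M -> R[i]) :
  tangent x v -> (forall i, smooth_at x (F i)) ->
  v (fun y => \sum_(i <- r) F i y) = \sum_(i <- r) v (F i).
Proof.
move=> tv sF; elim: r => [|i r IH].
  rewrite big_nil -[RHS](tan_cst 0 tv).
  by congr v; apply/funext => y; rewrite big_nil.
rewrite big_cons -IH -(tanD tv (sF i) (smooth_sum r sF)).
by congr v; apply/funext => y; rewrite big_cons.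
Qed.

Lemma tconjK v : tconj (tconj v) = v.
Proof.
apply/funext => f; rewrite /tconj conjcK; congr v.
by apply/funext => y; rewrite conjcK.
Qed.

Lemma fconjK X : fconj (fconj X) = X.
Proof. by apply/funext => y; exact: tconjK. Qed.

Lemma tconj_tlin a v w : tconj (tlin a v w) = tlin a^* (tconj v) (tconj w).
Proof. by apply/funext => f; rewrite /tconj /tlin rmorphD rmorphM. Qed.

Lemma tconj_app v f : tconj v (fun y => (f y)^*) = (v f)^*.
Proof.
by rewrite /tconj; congr (v _)^*; apply/funext => y; rewrite conjcK.
Qed.

(** Conjugating twice, before and after, restores C-linearity. *)
Lemma tangent_tconj x v : tangent x v -> tangent x (tconj v).
Proof.
move=> tv; have [n0 near lin leib] := tv; rewrite /tconj; split.
- by move=> f nf; rewrite n0 ?conjc0 // => /smooth_conjE.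
- by move=> f g fg; congr _^*; apply: near; apply: filterS fg => y ->.
- move=> a f g /smooth_conj sf /smooth_conj sg.
  rewrite -[a in RHS]conjcK -rmorphM -rmorphD -lin //=; congr (v _)^*.
  by apply/funext => y; rewrite rmorphD rmorphM.
- move=> f g /smooth_conj sf /smooth_conj sg.
  rewrite -[g x]conjcK -[f x]conjcK -!rmorphM -rmorphD -leib //=.
  by congr (v _)^*; apply/funext => y; rewrite rmorphM.
Qed.

Lemma tangent_tlin x a v w : tangent x v -> tangent x w ->
  tangent x (tlin a v w).
Proof.
move=> tv tw; rewrite /tlin; split.
- by move=> f nf; have [-> // _ _ _] := tv; have [-> // _ _ _] := tw;
    rewrite mulr0 addr0.
- by move=> f g fg; rewrite (tan_near tv fg) (tan_near tw fg).
- move=> b f g sf sg; have sbf := smoothM (smooth_cst x b) sf.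
  rewrite (tanD tv sbf sg) (tanD tw sbf sg) (tanZ b tv sf) (tanZ b tw sf).
  by ring.
- by move=> f g sf sg; rewrite (tanM tv sf sg) (tanM tw sf sg); ring.
Qed.

Lemma tangent0 x : tangent x (fun=> 0 : R[i]).
Proof.
by split=> // *; rewrite ?(mulr0, mul0r) addr0.
Qed.

Lemma tangent_tsum (I : finType) x (a : I -> R[i]) (v : I -> functional M) :
  (forall i, tangent x (v i)) -> tangent x (tsum a v).
Proof.
move=> tv; rewrite /tsum.
suff: forall r : seq I, tangent x (fun f => \sum_(i <- r) a i * v i f) by apply.
elim=> [|i r IH].
  have -> : (fun f => \sum_(i <- [::]) a i * v i f) = (fun=> 0).
    by apply/funext => f; rewrite big_nil.
  exact: tangent0.
have -> : (fun f => \sum_(j <- i :: r) a j * v j f)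
   = tlin (a i) (v i) (fun f => \sum_(j <- r) a j * v j f).
  by apply/funext => f; rewrite big_cons.
exact: tangent_tlin.
Qed.

Section Brackets.
Context (U : set M) (oU : open U).

Lemma vfield_tan X x : vfield U X -> U x -> tangent x (X x).
Proof. by move=> /[apply] -[]. Qed.

Lemma vfield_smooth X x f : vfield U X -> U x -> smooth_at x f ->
  smooth_at x (fun y => X y f).
Proof. by move=> /[apply] -[_]; exact. Qed.

Lemma vfield_fconj X : vfield U X -> vfield U (fconj X).
Proof.
move=> vX x Ux; split; first exact/tangent_tconj/vfield_tan.
by move=> f sf; apply/smooth_conj/vfield_smooth => //; apply/smooth_conj.
Qed.

Lemma bracketE X Y x f : smooth_at x f ->
  bracket X Y x f = X x (fun y => Y y f) - Y x (fun y => X y f).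
Proof. by move=> sf; rewrite /bracket asboolT. Qed.

Lemma bracket_near X Y x f : smooth_at x f -> \forall y \near x,
  bracket X Y y f = X y (fun z => Y z f) - Y y (fun z => X z f).
Proof.
by move=> /smooth_near; apply: filterS => y sf; exact: bracketE.
Qed.

(** The second-order terms of the two compositions cancel in the Leibniz rule.
Each inner derivation has to be rewritten on a neighbourhood, not only at
[x], before the outer one is applied. *)
Lemma vfield_bracket X Y : vfield U X -> vfield U Y -> vfield U (bracket X Y).
Proof.
move=> vX vY x Ux; have tX := vfield_tan vX Ux; have tY := vfield_tan vY Ux.
have sX f := @vfield_smooth X x f vX Ux; have sY f := @vfield_smooth Y x f vY Ux.
split; last first.
  move=> f sf; apply: smooth_at_near (smoothB (sX _ (sY _ sf)) (sY _ (sX _ sf))).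
  by apply: filterS (bracket_near X Y sf) => y ->.
have s_near g : smooth_at x g -> \forall y \near x, smooth_at y g /\ U y.
  move=> sg; apply: filterS2 (smooth_near sg) (near_open oU Ux (fun _ => id)).
  by move=> y sy Uy.
split.
- by move=> f nf; rewrite /bracket asboolF.
- move=> f g fg; have fg' : \forall y \near x, g y = f y by apply: filterS fg.
  have [sf|nf] := pselect (smooth_at x f); last first.
    rewrite /bracket !asboolF // => sg; apply: nf; exact: smooth_at_near fg' sg.
  rewrite !bracketE //; last exact: smooth_at_near fg sf.
  have E W : vfield U W -> \forall y \near x, W y f = W y g.
    move=> vW; apply: filterS2 (near_open oU Ux (fun _ => id))
      (near_join fg) => y Uy fgy.
    by have [_ H _ _] := vfield_tan vW Uy; exact: H.
  by rewrite (tan_near tX (E _ vY)) (tan_near tY (E _ vX)).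
- move=> a f g sf sg.
  have E W : vfield U W -> \forall y \near x,
      W y (fun z => a * f z + g z) = a * W y f + W y g.
    move=> vW; apply: filterS2 (s_near _ sf) (smooth_near sg).
    by move=> y [sfy Uy] sgy; have [_ _ H _] := vfield_tan vW Uy; exact: H.
  rewrite !bracketE //; last exact: smoothD (smoothM (smooth_cst x a) sf) sg.
  rewrite (tan_near tX (E _ vY)) (tan_near tY (E _ vX)).
  rewrite (tan_lin a tX (sY _ sf) (sY _ sg)) (tan_lin a tY (sX _ sf) (sX _ sg)).
  by ring.
- move=> f g sf sg.
  have E W : vfield U W -> \forall y \near x,
      W y (fun z => f z * g z) = W y f * g y + f y * W y g.
    move=> vW; apply: filterS2 (s_near _ sf) (smooth_near sg).
    by move=> y [sfy Uy] sgy; have [_ _ _ H] := vfield_tan vW Uy; exact: H.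
  rewrite !bracketE //; last exact: smoothM sf sg.
  rewrite (tan_near tX (E _ vY)) (tan_near tY (E _ vX)).
  have [sXf sXg sYf sYg] := And4 (sX _ sf) (sX _ sg) (sY _ sf) (sY _ sg).
  rewrite (tanD tX (smoothM sYf sg) (smoothM sf sYg)).
  rewrite (tanD tY (smoothM sXf sg) (smoothM sf sXg)).
  rewrite (tanM tX sYf sg) (tanM tX sf sYg) (tanM tY sXf sg) (tanM tY sf sXg).
  by ring.
Qed.

Lemma bracket_anti X Y x f : bracket Y X x f = - bracket X Y x f.
Proof. by rewrite /bracket; case: ifP => _; rewrite ?opprB ?oppr0. Qed.

Lemma tconj_bracket X Y x :
  tconj (bracket X Y x) = bracket (fconj X) (fconj Y) x.
Proof.
have cc W : (fun y => (W y)^*^*) = W :> (M -> R[i]).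
  by apply/funext => y; rewrite conjcK.
apply/funext => f; rewrite /tconj.
have [sf|nf] := pselect (smooth_at x f); last first.
  by rewrite /bracket !asboolF ?conjc0 //; rewrite smooth_conjE.
rewrite !bracketE //; last exact/smooth_conjE.
by rewrite rmorphB /fconj /tconj !cc.
Qed.

Lemma bracket_bracketE X Y Z x f : vfield U X -> vfield U Y -> vfield U Z ->
  U x -> smooth_at x f ->
  bracket (bracket X Y) Z x f =
    X x (fun y => Y y (fun z => Z z f)) - Y x (fun y => X y (fun z => Z z f))
    - (Z x (fun y => X y (fun z => Y z f)) - Z x (fun y => Y y (fun z => X z f))).
Proof.
move=> vX vY vZ Ux sf; have s W := vfield_smooth W Ux.
rewrite bracketE // bracketE; last exact: s.
have tZ := vfield_tan vZ Ux.
rewrite -(tanB tZ); try by apply: (s) => //; apply: (s).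
by congr (_ - _); apply: (tan_near tZ); exact: bracket_near.
Qed.

(** Each double bracket is an alternating sum of four third-order terms; the
twelve terms cancel in pairs.  On functions that are not smooth all brackets
vanish by convention. *)
Lemma jacobi X Y Z x : vfield U X -> vfield U Y -> vfield U Z -> U x ->
  forall f, bracket (bracket X Y) Z x f + bracket (bracket Y Z) X x f
          + bracket (bracket Z X) Y x f = 0.
Proof.
move=> vX vY vZ Ux f.
have [sf|nf] := pselect (smooth_at x f); last first.
  by rewrite /bracket !asboolF // !addr0.
by rewrite !bracket_bracketE //; ring.
Qed.

End Brackets.

Section Forms.
Context (U : set M) (oU : open U).
Implicit Type a : covector M.

Lemma form_tlin a x (c : R[i]) v w : one_form U a -> U x ->
  tangent x v -> tangent x w -> a x (tlin c v w) = c * a x v + a x w.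
Proof. by case=> lin _ Ux tv tw; exact: lin. Qed.

Lemma form0 a x : one_form U a -> U x -> a x (fun=> 0) = 0.
Proof.
move=> fa Ux; have := form_tlin (-1) fa Ux (tangent0 x) (tangent0 x).
rewrite mulN1r addNr => H; rewrite -[RHS]H; congr (a x _).
by apply/funext => f; rewrite /tlin mulr0 addr0.
Qed.

Lemma form_smooth a X x : one_form U a -> vfield U X -> U x ->
  smooth_at x (fun y => a y (X y)).
Proof. by case=> _ H vX; apply: (H U X). Qed.

(** One-forms are only known to be linear on tangent vectors, so the relation is
first solved for [u]. *)
Lemma form_sum0 a x u v w : one_form U a -> U x ->
  tangent x u -> tangent x v -> tangent x w ->
  (forall f, u f + v f + w f = 0) -> a x u + a x v + a x w = 0.
Proof.
move=> fa Ux tu tv tw uvw.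
have -> : u = tlin (-1) v (tlin (-1) w (fun=> 0)).
  apply/funext => f; apply/eqP; rewrite /tlin addr0 -subr_eq0 -(uvw f).
  by apply/eqP; ring.
have t0 := tangent0 x.
rewrite !(form_tlin _ fa Ux) // ?(form0 fa Ux); last exact: tangent_tlin.
by ring.
Qed.

Lemma form_tsum (I : finType) a x (c : I -> R[i]) (v : I -> functional M) :
  one_form U a -> U x -> (forall i, tangent x (v i)) ->
  a x (tsum c v) = \sum_i c i * a x (v i).
Proof.
move=> fa Ux tv; rewrite /tsum.
have E r : tangent x (fun f => \sum_(i <- r) c i * v i f) /\
  a x (fun f => \sum_(i <- r) c i * v i f) = \sum_(i <- r) c i * a x (v i).
  elim: r => [|i r [tr IH]].
    have -> : (fun f => \sum_(i <- [::]) c i * v i f) = (fun=> 0).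
      by apply/funext => f; rewrite big_nil.
    by rewrite big_nil (form0 fa Ux); split=> //; exact: tangent0.
  have -> : (fun f => \sum_(j <- i :: r) c j * v j f)
     = tlin (c i) (v i) (fun f => \sum_(j <- r) c j * v j f).
    by apply/funext => f; rewrite big_cons.
  by rewrite big_cons -IH (form_tlin _ fa Ux) //; split=> //; exact: tangent_tlin.
by have [_ ->] := E (index_enum I).
Qed.

Lemma one_form_conj a : one_form U a -> one_form U (form_conj a).
Proof.
move=> fa; split=> [x Ux c v w tv tw|V X oV VU vX x Vx].
  rewrite /form_conj tconj_tlin (form_tlin _ fa Ux); try exact: tangent_tconj.
  by rewrite rmorphD rmorphM /= conjcK.
by apply/smooth_conj; case: fa => _ /(_ V (fconj X)); apply=> //; exact: vfield_fconj.
Qed.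

Lemma form_conj_tconj a x v : form_conj a x (tconj v) = (a x v)^*.
Proof. by rewrite /form_conj tconjK. Qed.

End Forms.

End TangentVectors.

(** * The two traces of a curvature tensor *)

Section TraceExchange.
Context (K : comNzRingType) (m : nat).
Implicit Types (u v h hi : 'M[K]_m).

(** The full contraction u_(cd) v^(cd), where u has unbarred indices, v barred ones,
and [hi d c] is h^(c bar d). *)
Definition contract hi u v : K := \sum_c \sum_d \sum_c' \sum_d'
  hi c' c * hi d' d * u c d * v c' d'.

(** As a matrix trace, the contraction can be manipulated by cyclicity. *)
Lemma contract_tr hi u v : contract hi u v = \tr (v^T *m hi *m u *m hi^T).
Proof.
rewrite /contract /mxtrace.
under eq_bigr => c _.
  under eq_bigr => d _ do rewrite exchange_big.
  rewrite exchange_big; over.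
rewrite exchange_big; apply: eq_bigr => d' _; rewrite mxE exchange_big /=.
apply: eq_bigr => d _; rewrite !mxE mulr_suml; apply: eq_bigr => c _.
rewrite !mxE !mulr_suml; apply: eq_bigr => c' _.
by rewrite !mxE; ring.
Qed.

(** [Om a b d c] stands for R_(a bar b d)^c, and [n1], [n2] for the conjugate of the
Nijenhuis tensor and the tensor itself, with the last index raised.  The trace
of R_(a bar b c bar e) over c, bar e becomes the Ricci trace after exchanging
a with c and then bar b with bar e.  The two quadratic corrections are expressed, by skewness and the cyclic identity, through the two scalars
N_(acd) N_(bar b)^(cd) and N_(acd) N_(bar b)^(dc), and so is
N_(cda) N^(cd)_(bar b). *)
Lemma trace_curvature_exchange h hi (Om : 'I_m -> 'I_m -> 'I_m -> 'I_m -> K)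
    (n1 n2 : 'I_m -> 'M[K]_m) (a b : 'I_m) :
  let n1l a := n1 a *m h^T in
  let n2l a := n2 a *m h in
  let Oml a b d e := \sum_c Om a b d c * h c e in
  h *m hi = 1%:M ->
  (forall a c d, n1l a c d = - n1l c a d) ->
  (forall a c d, n1l a c d + n1l c d a + n1l d a c = 0) ->
  (forall a c d, n2l a c d = - n2l c a d) ->
  (forall a c d, n2l a c d + n2l c d a + n2l d a c = 0) ->
  (forall a b c d, Om a b d c - Om d b a c = - \sum_k n1 a d k * n2 k b c) ->
  (forall a b d e, Oml a b d e - Oml a e d b = - \sum_k n2 b e k * n1l k a d) ->
  \sum_c Om a b c c = \sum_c \sum_e hi e c * Oml c e a b
    + contract hi (n1l a) (n2l b)
    - contract hi (\matrix_(c, d) n1l c d a) (\matrix_(c, d) n2l c d b).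
Proof.
move=> n1l n2l Oml hK skl1 cy1 skl2 cy2 B1 B2.
have Kh : hi *m h = 1%:M by exact: mulmx1C.
have hKT : h^T *m hi^T = 1%:M by rewrite -trmx_mul Kh trmx1.
pose u := n1l a; pose v := n2l b.
have E1 c d : n1l c d a = u d c - u c d.
  apply/eqP; rewrite -subr_eq0 -(cy1 a c d) (skl1 d a c); apply/eqP.
  by rewrite /u; ring.
have E2 c d : n2l c d b = v d c - v c d.
  apply/eqP; rewrite -subr_eq0 -(cy2 b c d) (skl2 d b c); apply/eqP.
  by rewrite /v; ring.
have -> : \matrix_(c, d) n1l c d a = u^T - u by apply/matrixP => c d;
  rewrite [LHS]mxE E1 [RHS]mxE [u^T c d]mxE [(- u) c d]mxE.
have -> : \matrix_(c, d) n2l c d b = v^T - v by apply/matrixP => c d;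
  rewrite [LHS]mxE E2 [RHS]mxE [v^T c d]mxE [(- v) c d]mxE.
have uK : u *m hi^T = n1 a by rewrite /u /n1l -mulmxA hKT mulmx1.
have vK : v *m hi = n2 b by rewrite /v /n2l -mulmxA hK mulmx1.
have vE : n2l b = v by [].
rewrite -/u -/v; clearbody u v.
pose t := \tr (n2 b *m n1 a); pose t1 := \tr ((n2 b)^T *m hi *m u).
have T1 : contract hi u v = t1.
  by rewrite contract_tr mxtrace_mulC !mulmxA -trmx_mul vK.
have T2 : contract hi (u^T - u) (v^T - v) = t1 + t1 - t - t.
  have -> : contract hi (u^T - u) (v^T - v)
      = \tr ((v - v^T) *m hi *m (u^T - u) *m hi^T).
    by rewrite contract_tr; congr (\tr (_ *m _ *m _ *m _));
       apply/matrixP => i j; rewrite !mxE.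
  rewrite !(mulmxBl, mulmxBr) !raddfB /=.
  have -> : \tr (v *m hi *m u^T *m hi^T) = t1.
    rewrite vK -mxtrace_tr !trmx_mul !trmxK.
    by rewrite mulmxA mxtrace_mulC mulmxA.
  have -> : \tr (v *m hi *m u *m hi^T) = t by rewrite vK -mulmxA uK.
  have -> : \tr (v^T *m hi *m u^T *m hi^T) = t.
    rewrite -mxtrace_tr !trmx_mul !trmxK.
    by rewrite !mulmxA -[hi *m u *m _]mulmxA uK mxtrace_mulC mulmxA vK.
  have -> : \tr (v^T *m hi *m u *m hi^T) = t1 by rewrite -T1 contract_tr.
  ring.
have B1l c e : Oml a b c e - Oml c b a e = - \sum_k n1 a c k * n2l k b e.
  rewrite /Oml -sumrB; under eq_bigr => k _ do rewrite -mulrBl B1 mulNr mulr_suml.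
  rewrite sumrN exchange_big; congr (- _); apply: eq_bigr => k _.
  by rewrite /n2l mxE mulr_sumr; apply: eq_bigr => l _; rewrite mulrA.
have Q : \sum_c Om a b c c = \sum_c \sum_e hi e c * Oml a b c e.
  apply: eq_bigr => c _; rewrite /Oml; under eq_bigr => e _ do rewrite mulr_sumr.
  rewrite exchange_big /= (bigD1 c) //= [X in _ + X]big1 ?addr0 => [|k kc].
    have /matrixP/(_ c c) := hK; rewrite !mxE eqxx => H.
    rewrite -[LHS]mulr1 -[X in _ * X]H mulr_sumr.
    by apply: eq_bigr => e _; ring.
  have /matrixP/(_ k c) := hK; rewrite !mxE (negPf kc) => H.
  rewrite -[RHS](mulr0 (Om a b c k)) -[X in _ * X]H mulr_sumr.
  by apply: eq_bigr => e _; ring.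
have S1 : \sum_c \sum_e hi e c * \sum_k n1 a c k * n2l k b e = - t.
  rewrite /t mxtrace_mulC -vK mulmxA mxtrace_mulC mulmxA /mxtrace -sumrN exchange_big.
  apply: eq_bigr => e _; rewrite mxE -sumrN.
  under [RHS]eq_bigr => k _ do rewrite mxE mulr_suml -sumrN.
  rewrite [RHS]exchange_big; apply: eq_bigr => c _; rewrite mulr_sumr.
  by apply: eq_bigr => k _; rewrite (skl2 k b) vE; ring.
have S2 : \sum_c \sum_e hi e c * \sum_k n2 b e k * n1l k c a = t1 - t.
  have -> : t = \tr (hi^T *m n2 b *m u).
    by rewrite /t -uK mulmxA mxtrace_mulC mulmxA.
  rewrite /t1 /mxtrace.
  have -> : \sum_i ((n2 b)^T *m hi *m u) i i
      = \sum_c \sum_e \sum_k hi e c * n2 b e k * u c k.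
    transitivity (\sum_k \sum_c \sum_e hi e c * n2 b e k * u c k).
      apply: eq_bigr => k _; rewrite mxE; apply: eq_bigr => c _.
      by rewrite mxE mulr_suml; apply: eq_bigr => e _; rewrite mxE; ring.
    rewrite exchange_big; apply: eq_bigr => c _; exact: exchange_big.
  have -> : \sum_i (hi^T *m n2 b *m u) i i
      = \sum_c \sum_e \sum_k hi e c * n2 b e k * u k c.
    apply: eq_bigr => c _; rewrite mxE exchange_big; apply: eq_bigr => k _.
    by rewrite mxE mulr_suml; apply: eq_bigr => e _; rewrite mxE.
  rewrite -sumrB; apply: eq_bigr => c _; rewrite -sumrB; apply: eq_bigr => e _.
  by rewrite -sumrB mulr_sumr; apply: eq_bigr => k _; rewrite E1; ring.
rewrite T1 T2 Q.
have -> : \sum_c \sum_e hi e c * Oml a b c e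
   = \sum_c \sum_e hi e c * Oml c e a b
   - \sum_c \sum_e hi e c * (\sum_k n2 b e k * n1l k c a)
   - \sum_c \sum_e hi e c * (\sum_k n1 a c k * n2l k b e).
  rewrite -!sumrB; apply: eq_bigr => c _; rewrite -!sumrB; apply: eq_bigr => e _.
  have -> : Oml a b c e = Oml c e a b + (Oml c b a e - Oml c e a b)
     + (Oml a b c e - Oml c b a e) by ring.
  by rewrite B1l B2; ring.
rewrite S1 S2; ring.
Qed.

End TraceExchange.

(** * Curvature and brackets in an adapted frame *)

Section Connection.
Context (R : realType) (n m : nat) (M : manifold R n).
Implicit Types (G : 'I_m -> 'I_m -> covector M) (X Y : vecfield M).

(** The curvature two-form d Gamma_d^c - Gamma_d^k /\ Gamma_k^c. *)
Definition curvature_form G (d c : 'I_m) X Y : M -> R[i] := fun x =>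
  dform (G d c) X Y x + \sum_k wedge (G k c) (G d k) X Y x.

Lemma form_bracket_anti (U : set M) a X Y x : open U -> one_form U a ->
  vfield U X -> vfield U Y -> U x ->
  a x (bracket Y X x) = - a x (bracket X Y x).
Proof.
move=> oU fa vX vY Ux.
have -> : bracket Y X x = tlin (-1) (bracket X Y x) (fun=> 0).
  by apply/funext => f; rewrite bracket_anti /tlin addr0 mulN1r.
rewrite (form_tlin _ fa Ux) ?(form0 fa Ux) ?addr0 ?mulN1r //.
  exact: vfield_tan (vfield_bracket oU vX vY) Ux.
exact: tangent0.
Qed.

Lemma curvature_form_anti U G d c X Y x : open U ->
  (forall d c, one_form U (G d c)) -> vfield U X -> vfield U Y -> U x ->
  curvature_form G d c Y X x = - curvature_form G d c X Y x.
Proof.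
move=> oU fG vX vY Ux; rewrite /curvature_form /dform.
rewrite (form_bracket_anti oU (fG d c) vX vY Ux) opprD -sumrN.
by congr (_ + _); [ring | apply: eq_bigr => k _; rewrite /wedge; ring].
Qed.

Lemma curvature_form_conj G d c X Y x :
  curvature_form (fun d c => form_conj (G d c)) d c X Y x =
  (curvature_form G d c (fconj X) (fconj Y) x)^*.
Proof.
rewrite /curvature_form /dform /wedge !rmorphD !rmorphN rmorph_sum /=.
congr (_ + _ - _ + _).
- exact/esym/conjcK.
- by congr (- _); exact/esym/conjcK.
- by rewrite /form_conj tconj_bracket.
- by apply: eq_bigr => k _; rewrite rmorphB !rmorphM.
Qed.

End Connection.

Section WebsterFrame.
Context (R : realType) (m : nat) (M : almostCR R m) (E : canonical_root M).
Context (theta : covector M) (theta_ph : pseudo_hermitian theta).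
Context (F : webster E theta).
Local Notation W := (wdom F).
Local Notation T := (reeb F).
Local Notation e := (fr F).
Local Notation eb := (fun a => fconj (fr F a)).
Local Notation th := (cofr F).
Local Notation thb := (fun a => form_conj (cofr F a)).
Local Notation Gam := (gam F).
Local Notation Gamb := (fun b a => form_conj (gam F b a)).
Implicit Types (a b c d : 'I_m) (x : M) (X Y Z : vecfield M).

Let oW : open W := wdom_open F.

Lemma theta_form : one_form W theta.
Proof.
case: (ph_form theta_ph) => lin sm; split=> [x _|V X oV _]; first exact: lin.
exact: sm.
Qed.

Lemma theta_Hdist x v : Hdist x v -> theta x v = 0.
Proof. by move=> Hv; have [tv rv] := H_tangent Hv; apply/ph_ker. Qed.

Lemma vfield_reeb : vfield W T. Proof. exact: reeb_field. Qed.
Lemma vfield_fr a : vfield W (e a). Proof. by case: (fr_section F a). Qed.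
Lemma vfield_frb a : vfield W (eb a). Proof. exact/vfield_fconj/vfield_fr. Qed.
Hint Resolve vfield_reeb vfield_fr vfield_frb : core.

Lemma theta_fr a x : W x -> theta x (e a x) = 0.
Proof.
move=> Wx; have [_ /(_ x Wx) [u [w [Hu Hw -> _]]]] := fr_section F a.
have [tu _] := H_tangent Hu; have [tw _] := H_tangent Hw.
by rewrite (form_tlin _ theta_form Wx) // !theta_Hdist // mulr0 addr0.
Qed.

Lemma theta_frb a x : W x -> theta x (fconj (e a) x) = 0.
Proof.
move=> Wx; rewrite /fconj (ph_real theta_ph) ?theta_fr ?conjc0 //.
exact: vfield_tan (vfield_fr a) Wx.
Qed.

Lemma cofrb_fr a b x : W x -> form_conj (th a) x (e b x) = 0.
Proof. by move=> Wx; rewrite /form_conj (cofr_frb a b Wx) conjc0. Qed.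

Lemma cofrb_frb a b x : W x -> form_conj (th a) x (fconj (e b) x) = (a == b)%:R.
Proof. by move=> Wx; rewrite /fconj form_conj_tconj cofr_fr // conjc_nat. Qed.

Lemma theta_bracket X Y x : W x -> vfield W X -> vfield W Y ->
  theta x (bracket X Y x) = X x (fun y => theta y (Y y))
    - Y x (fun y => theta y (X y))
    - 'i * \sum_a \sum_b levi F x a b * wedge (th a) (form_conj (th b)) X Y x.
Proof.
by move=> Wx vX vY; rewrite -(eq_dtheta oW _ vX vY Wx) // /dform; ring.
Qed.

Lemma vfield_eq_cst X (f : M -> R[i]) k x : W x -> vfield W X ->
  (forall y, W y -> f y = k) -> X x f = 0.
Proof.
move=> Wx vX f0; have tX := vfield_tan vX Wx.
by rewrite (tan_eq_on tX oW Wx f0) (tan_cst k tX).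
Qed.

Lemma theta_bracket_fr_frb a b x : W x ->
  theta x (bracket (e a) (eb b) x) = - 'i * levi F x a b.
Proof.
move=> Wx; rewrite theta_bracket //.
rewrite (vfield_eq_cst (k := 0) Wx) //; last by move=> y; exact: theta_frb.
rewrite (vfield_eq_cst (k := 0) Wx) //; last by move=> y; exact: theta_fr.
rewrite subr0 sub0r mulNr; congr (- ('i * _)).
rewrite -[RHS](sum_delta a (fun k => levi F x k b)).
apply: eq_bigr => k _; rewrite -(sum_delta b (fun l => (k == a)%:R * levi F x k l)).
apply: eq_bigr => l _.
by rewrite /wedge cofr_fr // cofrb_frb // cofrb_fr //; ring.
Qed.

Lemma theta_bracket_fr_fr a b x : W x -> theta x (bracket (e a) (e b) x) = 0.
Proof.
move=> Wx; rewrite theta_bracket //.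
rewrite (vfield_eq_cst (k := 0) Wx) //; last by move=> y; exact: theta_fr.
rewrite (vfield_eq_cst (k := 0) Wx) //; last by move=> y; exact: theta_fr.
rewrite big1 ?mulr0 ?subr0 // => a' _; rewrite big1 // => b' _.
by rewrite /wedge !cofrb_fr // !mulr0 subr0 mulr0.
Qed.

(** The structure equation for [d th c], read as a formula for the bracket.  It is
stated for an arbitrary [Z] so that it also applies to double brackets, without
expanding the inner one in the frame. *)
Lemma cofr_bracket_fr Z a c x : vfield W Z -> W x ->
  th c x (bracket Z (e a) x) = - e a x (fun y => th c y (Z y))
    - \sum_k th k x (Z x) * Gam k c x (e a x) + Gam a c x (Z x).
Proof.
move=> vZ Wx; have := eq_dcofr c oW (fun y => id) vZ (vfield_fr a) Wx.
rewrite [X in X = _ -> _]/dform (vfield_eq_cst (k := (c == a)%:R) Wx) //; last first.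
  by move=> y; exact: cofr_fr.
rewrite sub0r [X in _ = _ + X - _ -> _]big1 ?addr0; last first.
  by move=> b _; rewrite /wedge cofrb_fr // theta_fr // mulr0 mul0r subr0 mulr0.
rewrite [X in _ = _ - _ * X -> _]big1 ?mulr0 ?subr0; last first.
  move=> b _; rewrite big1 // => k _.
  by rewrite /wedge !cofrb_fr // mulr0 mul0r subr0 mulr0.
have -> : \sum_b wedge (th b) (Gam b c) Z (e a) x =
  \sum_k th k x (Z x) * Gam k c x (e a x) - Gam a c x (Z x).
  rewrite -(sum_delta a (fun k => Gam k c x (Z x))) -sumrB.
  by apply: eq_bigr => k _; rewrite /wedge cofr_fr.
move=> H; apply/eqP; rewrite -subr_eq0; apply/eqP.
by move/eqP: H; rewrite -subr_eq0 => /eqP H; rewrite -[RHS]oppr0 -[in RHS]H; ring.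
Qed.

(** As for [cofr_bracket_fr]; here the torsion terms survive, and skewness of the
Nijenhuis tensor absorbs the factor 1/2. *)
Lemma cofr_bracket_frb Z b c x : vfield W Z -> W x ->
  th c x (bracket Z (eb b) x) = - eb b x (fun y => th c y (Z y))
    - \sum_k th k x (Z x) * Gam k c x (eb b x) - tors F c b x * theta x (Z x)
    + \sum_k nij F k b c x * form_conj (th k) x (Z x).
Proof.
move=> vZ Wx; have := eq_dcofr c oW (fun y => id) vZ (vfield_frb b) Wx.
rewrite [X in X = _ -> _]/dform (vfield_eq_cst (k := 0) Wx) //; last first.
  by move=> y; exact: cofr_frb.
rewrite sub0r.
have -> : \sum_b0 wedge (th b0) (Gam b0 c) Z (eb b) x =
  \sum_k th k x (Z x) * Gam k c x (eb b x).
  by apply: eq_bigr => k _; rewrite /wedge cofr_frb // mul0r subr0.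
have -> : \sum_b0 tors F c b0 x * wedge theta (form_conj (th b0)) Z (eb b) x
  = tors F c b x * theta x (Z x).
  rewrite -(sum_delta b (fun k => tors F c k x * theta x (Z x))).
  apply: eq_bigr => k _.
  by rewrite /wedge theta_frb // cofrb_frb // mul0r subr0; ring.
have -> : \sum_k \sum_l nij F k l c x *
    wedge (form_conj (th k)) (form_conj (th l)) Z (eb b) x
  = 2%:R * \sum_k nij F k b c x * form_conj (th k) x (Z x).
  transitivity (\sum_k nij F k b c x * form_conj (th k) x (Z x)
     - \sum_k nij F b k c x * form_conj (th k) x (Z x)); last first.
    rewrite -sumrB mulr_sumr; apply: eq_bigr => k _.
    by rewrite (nij_skew b k) //; ring.
  rewrite -(sum_delta b (fun k => \sum_l nij F k l c x * form_conj (th l) x (Z x))).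
  rewrite -sumrB; apply: eq_bigr => k _.
  rewrite -(sum_delta b (fun l => nij F k l c x * form_conj (th k) x (Z x))).
  rewrite mulr_sumr -sumrB; apply: eq_bigr => l _.
  by rewrite /wedge !cofrb_frb //; ring.
rewrite mulrA mulVf ?pnatr_eq0 // mul1r.
move=> H; apply/eqP; rewrite -subr_eq0; apply/eqP.
by move/eqP: H; rewrite -subr_eq0 => /eqP H; rewrite -[RHS]oppr0 -[in RHS]H; ring.
Qed.

Lemma cofr_bracket_fr_frb a b c x : W x ->
  th c x (bracket (e a) (eb b) x) = - Gam a c x (eb b x).
Proof.
move=> Wx; rewrite cofr_bracket_frb // theta_fr // mulr0 subr0.
rewrite (vfield_eq_cst (k := (c == a)%:R) Wx) //; last by move=> y; exact: cofr_fr.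
rewrite [X in _ + X]big1 ?addr0 => [|k _]; last by rewrite cofrb_fr ?mulr0.
under eq_bigr => k _ do rewrite cofr_fr //.
by rewrite sum_delta oppr0 sub0r.
Qed.

Lemma cofr_bracket_frb_fr a b c x : W x ->
  th c x (bracket (eb b) (e a) x) = Gam a c x (eb b x).
Proof.
move=> Wx.
rewrite (form_bracket_anti oW (cofr_form F c) (vfield_fr a) (vfield_frb b) Wx).
by rewrite cofr_bracket_fr_frb // opprK.
Qed.

Lemma cofrb_bracket_fr_frb a b c x : W x ->
  form_conj (th c) x (bracket (e a) (eb b) x) = form_conj (Gam b c) x (e a x).
Proof.
move=> Wx; rewrite /form_conj tconj_bracket.
have -> : fconj (eb b) = e b by exact: fconjK.
by rewrite cofr_bracket_frb_fr.
Qed.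

Lemma cofr_bracket_fr_fr a b c x : W x ->
  th c x (bracket (e a) (e b) x) = Gam b c x (e a x) - Gam a c x (e b x).
Proof.
move=> Wx; rewrite cofr_bracket_fr //.
rewrite (vfield_eq_cst (k := (c == a)%:R) Wx) //; last by move=> y; exact: cofr_fr.
under eq_bigr => k _ do rewrite cofr_fr //.
by rewrite sum_delta oppr0 sub0r addrC.
Qed.

Lemma cofrb_bracket_fr_fr a b c x : W x ->
  form_conj (th c) x (bracket (e a) (e b) x) = (nij F a b c x)^*.
Proof.
move=> Wx; rewrite /form_conj tconj_bracket; congr _^*.
rewrite cofr_bracket_frb // theta_frb // mulr0 subr0.
rewrite (vfield_eq_cst (k := 0) Wx) //; last by move=> y; exact: cofr_frb.
rewrite [X in - 0 - X]big1 => [|k _]; last by rewrite cofr_frb ?mul0r.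
rewrite subr0 oppr0 add0r.
under eq_bigr => k _ do rewrite cofrb_frb // mulrC.
exact: sum_delta.
Qed.

(** The matrix is read off from the bracket of [e a] and the conjugate of [e b];
conjugation, with [theta] real, exchanges the two up to a sign. *)
Lemma levi_herm a b x : W x -> levi F x a b = (levi F x b a)^*.
Proof.
move=> Wx; have i0 : 'i != 0 :> R[i] by rewrite neq0Ci.
apply: (mulfI i0); apply: oppr_inj; rewrite -!mulNr -theta_bracket_fr_frb //.
have tB : tangent x (bracket (e b) (eb a) x).
  exact: (vfield_tan (vfield_bracket oW (vfield_fr b) (vfield_frb a)) Wx).
have H := ph_real theta_ph tB; rewrite tconj_bracket in H.
have eK : fconj (eb a) = e a by exact: fconjK.
rewrite eK (form_bracket_anti oW theta_form (vfield_fr a) (vfield_frb b) Wx) in H.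
rewrite -[LHS]opprK H theta_bracket_fr_frb // rmorphM rmorphN /= -mulNr opprK.
by congr (_ * _); apply/eqP; rewrite eq_complex /= oppr0 !eqxx.
Qed.

(** A kernel vector c of the Levi matrix gives the real vector
c^a e_a + conjugate in H, whose d theta-pairing with all of H vanishes.  Every
bracket of sections of H starting from it then stays in H, against the contact
condition. *)
Lemma levi_unit x : W x -> levi F x \in unitmx.
Proof.
move=> Wx; rewrite unitmxE unitfE; apply/det0P => -[c c0 cl0].
have te a : tangent x (e a x) := vfield_tan (vfield_fr a) Wx.
pose w := tsum (c ord0) (fun a => e a x).
have tw : tangent x w by exact: tangent_tsum.
have tcw := tangent_tconj tw.
pose v := tlin 1 w (tconj w).
have tv : tangent x v by exact: tangent_tlin.
have rv : treal v.
  rewrite /treal /v tconj_tlin tconjK.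
  by apply/funext => f; rewrite /tlin conjc1 !mul1r addrC.
have thw : theta x w = 0.
  rewrite (form_tsum _ theta_form Wx te) big1 // => a _.
  by rewrite theta_fr // mulr0.
have Hv : Hdist x v.
  apply/(ph_ker theta_ph) => //.
  rewrite (form_tlin _ theta_form Wx) // (ph_real theta_ph tw) thw.
  by rewrite conjc0 mulr0 addr0.
have cofr_v a : th a x v = c ord0 a.
  have fa := cofr_form F a; rewrite (form_tlin _ fa Wx) // mul1r.
  rewrite (form_tsum _ fa Wx te) -[th a x (tconj w)]conjcK.
  rewrite [(th a x _)^*](form_tsum _ (one_form_conj fa) Wx te).
  rewrite [X in X^*]big1 ?conjc0 ?addr0 => [|b _]; last first.
    by rewrite cofrb_fr // mulr0.
  under eq_bigr => b _ do rewrite cofr_fr // mulrC.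
  exact: sum_delta_sym.
have thbv a : form_conj (th a) x v = (c ord0 a)^* by rewrite /form_conj rv cofr_v.
(* The coordinates of v in the frame are those of c and their conjugates. *)
have v0 : v <> (fun=> 0).
  move=> v0; move/eqP: c0; apply; apply/rowP => a.
  by rewrite mxE -cofr_v v0 (form0 (cofr_form F a) Wx).
have [U [X [Y [oU Ux [vX HX] [vY HY] [Xx]]]]] := H_contact Hv v0; apply.
have cl b : \sum_a c ord0 a * levi F x a b = 0.
  by move/rowP: cl0 => /(_ b); rewrite !mxE.
have lc a : \sum_b levi F x a b * (c ord0 b)^* = 0.
  transitivity ((\sum_b c ord0 b * levi F x b a)^*); last by rewrite cl conjc0.
  by rewrite rmorph_sum; apply: eq_bigr => b _; rewrite levi_herm // rmorphM mulrC.
have oV : open (U `&` W) by exact: openI.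
have VX : vfield (U `&` W) X by move=> y [Uy _]; exact: vX.
have VY : vfield (U `&` W) Y by move=> y [Uy _]; exact: vY.
have tB : tangent x (bracket X Y x).
  by apply: (vfield_tan (vfield_bracket oV VX VY)).
(* theta vanishes along sections of H, so only the bracket term of dform is left. *)
have z Z Z' : vfield (U `&` W) Z -> (forall y, U y -> Hdist y (Z' y)) ->
    Z x (fun y => theta y (Z' y)) = 0.
  move=> vZ HZ'; have tZ : tangent x (Z x) by apply: (vfield_tan vZ).
  rewrite -[RHS](tan_cst 0 tZ).
  by apply: (tan_eq_on tZ oU Ux) => y Uy; rewrite theta_Hdist //; exact: HZ'.
apply/(ph_ker theta_ph) => //.
  rewrite /treal tconj_bracket; apply/funext => f.
  have rX y : U y -> fconj X y = X y by move=> /HX /H_tangent [].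
  have rY y : U y -> fconj Y y = Y y by move=> /HY /H_tangent [].
  rewrite /bracket rX // rY //; case: ifP => // _; congr (_ - _).
    by apply: (tan_eq_on (vfield_tan vX Ux) oU Ux) => y Uy; rewrite rY.
  by apply: (tan_eq_on (vfield_tan vY Ux) oU Ux) => y Uy; rewrite rX.
have VW : U `&` W `<=` W by move=> y [].
have := eq_dtheta oV VW VX VY (conj Ux Wx).
rewrite /dform !z // subrr sub0r.
under eq_bigr => a _ do under eq_bigr => b _ do
  rewrite /wedge Xx cofr_v thbv mulrBr.
under eq_bigr => a _ do rewrite sumrB.
rewrite sumrB [X in _ * (X - _)]exchange_big /=.
rewrite [X in _ * (X - _)]big1 => [|b _]; last first.
  under eq_bigr => a _ do rewrite mulrA [_ * c _ _]mulrC.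
  by rewrite -mulr_suml cl mul0r.
rewrite [X in _ * (_ - X)]big1 ?subrr ?mulr0 => [|a _]; last first.
  under eq_bigr => b _ do rewrite [th a _ _ * _]mulrC mulrA.
  by rewrite -mulr_suml lc mul0r.
by move/eqP; rewrite oppr_eq0 => /eqP.
Qed.

(** A one-form is evaluated on brackets through their components in the frame. *)
Lemma form_span (a : covector M) x v : one_form W a -> W x -> tangent x v ->
  a x v = theta x v * a x (T x) + \sum_k th k x v * a x (e k x)
          + \sum_k form_conj (th k) x v * a x (fconj (e k) x).
Proof.
move=> fa Wx tv.
have te k : tangent x (e k x) := vfield_tan (vfield_fr k) Wx.
have teb k : tangent x (fconj (e k) x) := vfield_tan (vfield_frb k) Wx.
have tT : tangent x (T x) := vfield_tan vfield_reeb Wx.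
have {1}-> : v = tlin (theta x v) (T x)
   (tlin 1 (tsum (fun k => th k x v) (fun k => e k x))
     (tsum (fun k => form_conj (th k) x v) (fun k => fconj (e k) x))).
  apply/funext => f; rewrite {1}(frame_span Wx tv f) /tlin /tsum mul1r.
  by rewrite addrA.
have t1 := tangent_tsum (fun k => th k x v) te.
have t2 := tangent_tsum (fun k => form_conj (th k) x v) teb.
rewrite !(form_tlin _ fa Wx) //; last exact: tangent_tlin.
by rewrite !(form_tsum _ fa Wx) // mul1r addrA.
Qed.

Lemma tangent_bracket X Y x : vfield W X -> vfield W Y -> W x ->
  tangent x (bracket X Y x).
Proof. by move=> vX vY Wx; exact: vfield_tan (vfield_bracket oW vX vY) Wx. Qed.

Lemma gam_smooth d c X x : vfield W X -> W x ->
  smooth_at x (fun y => Gam d c y (X y)).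
Proof. by move=> vX Wx; exact: form_smooth oW _ X x (gam_form F d c) vX Wx. Qed.

Lemma gamb_form d c : one_form W (form_conj (Gam d c)).
Proof. exact: one_form_conj (gam_form F d c). Qed.

Lemma gamb_smooth d c X x : vfield W X -> W x ->
  smooth_at x (fun y => form_conj (Gam d c) y (X y)).
Proof. by move=> vX Wx; exact: form_smooth oW _ X x (gamb_form d c) vX Wx. Qed.

(** The [th c]-component of the Jacobi identity for e_a, e_d, bar e_b.  The first
double bracket sees the barred part of [e_a, e_d], which is the conjugate
Nijenhuis tensor; all
the remaining terms assemble into the two curvatures. *)
Lemma bianchi a b c d x : W x ->
  curvature_form Gam d c (e a) (eb b) x - curvature_form Gam a c (e d) (eb b) x
  = - \sum_k (nij F a d k x)^* * nij F k b c x.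
Proof.
move=> Wx; have tB := tangent_bracket.
have vB X Y : vfield W X -> vfield W Y -> vfield W (bracket X Y).
  exact: vfield_bracket.
have := form_sum0 (cofr_form F c) Wx
  (tB _ _ _ (vB _ _ (vfield_fr a) (vfield_fr d)) (vfield_frb b) Wx)
  (tB _ _ _ (vB _ _ (vfield_fr d) (vfield_frb b)) (vfield_fr a) Wx)
  (tB _ _ _ (vB _ _ (vfield_frb b) (vfield_fr a)) (vfield_fr d) Wx)
  (jacobi (vfield_fr a) (vfield_fr d) (vfield_frb b) Wx).
rewrite cofr_bracket_frb ?cofr_bracket_fr //; try exact: vB.
have tE k : tangent x (e k x) := vfield_tan (vfield_fr k) Wx.
have tEb k : tangent x (fconj (e k) x) := vfield_tan (vfield_frb k) Wx.
rewrite (tan_eq_on (tEb b) oW Wx (fun y Wy => cofr_bracket_fr_fr a d c Wy)).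
rewrite (tan_eq_on (tE a) oW Wx (fun y Wy => cofr_bracket_fr_frb d b c Wy)).
rewrite (tan_eq_on (tE d) oW Wx (fun y Wy => cofr_bracket_frb_fr a b c Wy)).
have sG i j X : vfield W X -> smooth_at x (fun y => Gam i j y (X y)).
  by move=> vX; exact: gam_smooth.
rewrite (tanB (tEb b) (sG d c (e a) (vfield_fr a)) (sG a c (e d) (vfield_fr d))).
rewrite (tanN (tE a) (sG d c (eb b) (vfield_frb b))).
rewrite theta_bracket_fr_fr // mulr0 subr0.
under eq_bigr => k _ do rewrite cofr_bracket_fr_fr // mulrBl.
under [X in _ + X + _ + _ = 0]eq_bigr => k _ do
  rewrite cofrb_bracket_fr_fr // mulrC.
under [X in _ + (_ - X + _) + _ = 0]eq_bigr => k _ do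
  rewrite cofr_bracket_fr_frb // mulNr.
under [X in _ + (_ - X + _) = 0]eq_bigr => k _ do rewrite cofr_bracket_frb_fr //.
rewrite (form_bracket_anti oW (gam_form F d c) (vfield_fr a) (vfield_frb b) Wx).
rewrite sumrB sumrN /curvature_form /dform /wedge !sumrB => H.
rewrite -[LHS]subr0 -[X in _ - X = _]H.
under [X in _ + (X - _) - _ - _]eq_bigr => k _ do rewrite mulrC.
under [X in _ + (_ - X) - _ - _]eq_bigr => k _ do rewrite mulrC.
under [X in _ - (_ + (X - _)) - _]eq_bigr => k _ do rewrite mulrC.
under [X in _ - (_ + (_ - X)) - _]eq_bigr => k _ do rewrite mulrC.
ring.
Qed.

(** The commutator of two derivatives of the parallel Levi matrix; the products of
one [Gam] and one conjugate [Gam] are symmetric in the two fields and drop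
out. *)
Lemma levi_curvature d e' X Y x : W x -> vfield W X -> vfield W Y ->
  \sum_c curvature_form Gam d c X Y x * levi F x c e'
  + \sum_c curvature_form Gamb e' c X Y x * levi F x d c = 0.
Proof.
move=> Wx vX vY.
have sl i j : smooth_at x (fun y => levi F y i j) := levi_smooth i j Wx.
have sG i j Z (vZ : vfield W Z) := gam_smooth i j vZ Wx.
have sGb i j Z (vZ : vfield W Z) := gamb_smooth i j vZ Wx.
pose D Z i j y := \sum_c Gam i c y (Z y) * levi F y c j
                + \sum_c form_conj (Gam j c) y (Z y) * levi F y i c.
have DE Z y i j : vfield W Z -> W y -> Z y (fun y => levi F y i j) = D Z i j y.
  by move=> vZ Wy; apply: levi_parallel => //; exact: vfield_tan vZ Wy.
pose S (G : 'I_m -> 'I_m -> covector M) i c Z Z' :=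
  Z x (fun y => G i c y (Z' y)) + \sum_k G k c x (Z x) * G i k x (Z' x).
(* The mixed products: B Z Z' + B Z' Z is symmetric in the two fields. *)
pose B Z Z' := \sum_c \sum_k
  Gam d c x (Z' x) * form_conj (Gam e' k) x (Z x) * levi F x c k.
have D2 Z Z' : vfield W Z -> vfield W Z' ->
    Z x (fun y => Z' y (fun y => levi F y d e'))
  = \sum_c S Gam d c Z Z' * levi F x c e'
    + \sum_c S Gamb e' c Z Z' * levi F x d c + (B Z Z' + B Z' Z).
  move=> vZ vZ'; have tZ := vfield_tan vZ Wx.
  rewrite (tan_eq_on tZ oW Wx (fun y Wy => DE Z' y d e' vZ' Wy)) /D.
  have s1 c : smooth_at x (fun y => Gam d c y (Z' y) * levi F y c e').
    by apply: smoothM; [exact: sG|exact: sl].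
  have s2 c : smooth_at x (fun y => form_conj (Gam e' c) y (Z' y) * levi F y d c).
    by apply: smoothM; [exact: sGb|exact: sl].
  rewrite (tanD tZ (smooth_sum _ s1) (smooth_sum _ s2)).
  rewrite (tan_sum _ tZ s1) (tan_sum _ tZ s2).
  under eq_bigr => c _ do rewrite (tanM tZ (sG d c _ vZ') (sl c e')) DE // mulrDr.
  under [X in _ + X]eq_bigr => c _ do
    rewrite (tanM tZ (sGb e' c _ vZ') (sl d c)) DE // mulrDr.
  have E1 (G : 'I_m -> 'I_m -> covector M) i (h : 'I_m -> R[i]) :
    \sum_c S G i c Z Z' * h c = \sum_c Z x (fun y => G i c y (Z' y)) * h c
     + \sum_c G i c x (Z' x) * \sum_k G c k x (Z x) * h k.
    rewrite /S; under eq_bigr => c _ do rewrite mulrDl mulr_suml.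
    rewrite big_split exchange_big /=; congr (_ + _); apply: eq_bigr => c _.
    by rewrite mulr_sumr; apply: eq_bigr => k _; ring.
  have E2 : B Z Z' = \sum_c Gam d c x (Z' x) *
      \sum_k form_conj (Gam e' k) x (Z x) * levi F x c k.
    apply: eq_bigr => c _; rewrite mulr_sumr.
    by apply: eq_bigr => k _; rewrite mulrA.
  have E3 : B Z' Z = \sum_c form_conj (Gam e' c) x (Z' x) *
      \sum_k Gam d k x (Z x) * levi F x k c.
    rewrite /B exchange_big; apply: eq_bigr => c _; rewrite mulr_sumr.
    by apply: eq_bigr => k _; ring.
  rewrite !E1 E2 E3 !big_split /=; ring.
have cfE (G : 'I_m -> 'I_m -> covector M) i (h : 'I_m -> R[i]) :
  \sum_c curvature_form G i c X Y x * h c = \sum_c S G i c X Y * h c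
   - \sum_c S G i c Y X * h c - \sum_c G i c x (bracket X Y x) * h c.
  rewrite -!sumrB; apply: eq_bigr => c _.
  by rewrite /curvature_form /dform /wedge /S sumrB; ring.
have := levi_parallel d e' Wx (tangent_bracket vX vY Wx).
rewrite bracketE // !D2 // !cfE => H.
apply/eqP; rewrite -subr_eq0 subr0; apply/eqP.
move/eqP: H; rewrite -subr_eq0 => /eqP H; rewrite -[RHS]H; ring.
Qed.
End WebsterFrame.

(** * The Ricci traces of the Webster connection *)

Section WebsterCurvature.
Context (R : realType) (m : nat) (M : almostCR R m) (E : canonical_root M).
Context (theta : covector M) (theta_ph : pseudo_hermitian theta).
Context (F : webster E theta).
Local Notation W := (wdom F).
Local Notation T := (reeb F).
Local Notation e := (fr F).
Local Notation eb := (fun a => fconj (fr F a)).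
Local Notation Gam := (gam F).
Local Notation Gamb := (fun b a => form_conj (gam F b a)).
Local Notation h x := (levi F x).
Local Notation hi x := (invmx (levi F x)).
Implicit Types (a b c d : 'I_m) (x : M) (X Y Z : vecfield M).

Let oW : open W := wdom_open F.

(** The power function vanishes at 0, so this depends on the nondegeneracy of the
Levi matrix. *)
Lemma scale_neq0 x : W x -> scale_comp F x != 0.
Proof.
move=> Wx; rewrite /scale_comp eq_complex /= eqxx andbT; apply: lt0r_neq0.
apply: powR_gt0; rewrite lt_neqAle eq_sym; apply/andP; split; last first.
  by case: (\det _) => p q; exact: sqrtr_ge0.
apply/eqP => /ComplexField.Normc.eq0_normc d0.
by have := levi_unit theta_ph Wx; rewrite unitmxE unitfE d0 eqxx.
Qed.

Lemma scale_conj x : (scale_comp F x)^* = scale_comp F x.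
Proof. exact: conjc_real. Qed.

Lemma blevi_invE c b x : W x ->
  blevi_inv F x c b = (scale_comp F x)^-1 * hi x b c.
Proof.
move=> Wx; have s0 := scale_neq0 Wx; have u := levi_unit theta_ph Wx.
by rewrite /blevi_inv /blevi invmxZ ?mxE // unitmxZ // unitfE.
Qed.

Lemma nabv_cst X c d x : W x -> vfield W X ->
  nabv F X (fun k _ => (k == d)%:R) c x = Gam d c x (X x).
Proof.
move=> Wx vX; rewrite /nabv (tan_cst _ (vfield_tan vX Wx)) add0r.
by under eq_bigr => k _ do rewrite mulrC; exact: sum_delta.
Qed.

(** The last terms of [curv] are - Gamma evaluated on the bracket of [e a] and
[eb b]; the scale of the weighted Levi form cancels that of the weighted Reeb
field. *)
Lemma curvE a b d c x : W x ->
  curv F a b d c x = curvature_form Gam d c (e a) (eb b) x.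
Proof.
move=> Wx; have s0 := scale_neq0 Wx.
have vE k : vfield W (e k) := vfield_fr k; have vEb k : vfield W (eb k) := vfield_frb k.
have tE k : tangent x (e k x) := vfield_tan (vE k) Wx.
have tEb k : tangent x (fconj (e k) x) := vfield_tan (vEb k) Wx.
rewrite /curv /curv_op /nab_reeb nabv_cst //; last exact: vfield_reeb.
rewrite /nabm {1 4}/nabv.
rewrite (tan_eq_on (tE a) oW Wx (fun y Wy => nabv_cst c d Wy (vEb b))).
rewrite (tan_eq_on (tEb b) oW Wx (fun y Wy => nabv_cst c d Wy (vE a))).
under eq_bigr => k _ do rewrite nabv_cst //.
under [X in _ - X - _ + _]eq_bigr => k _ do rewrite nabv_cst //.
under [X in _ - (_ + X - _) + _]eq_bigr => k _ do rewrite nabv_cst //.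
under [X in _ - (_ - X) + _]eq_bigr => k _ do rewrite nabv_cst //.
rewrite /curvature_form /dform.
rewrite (form_span (gam_form F d c) Wx (tangent_bracket (vE a) (vEb b) Wx)).
rewrite (theta_bracket_fr_frb theta_ph) //.
under [X in _ = _ - (_ + X + _) + _]eq_bigr => k _ do
  rewrite (cofr_bracket_fr_frb theta_ph) // mulNr.
under [X in _ = _ - (_ + X) + _]eq_bigr => k _ do
  rewrite (cofrb_bracket_fr_frb theta_ph) //.
rewrite sumrN /wedge sumrB /blevi mxE.
have -> : 'i * (scale_comp F x * h x a b) *
  ((scale_comp F x)^-1 * Gam d c x (T x)) = 'i * h x a b * Gam d c x (T x).
  by field.
ring.
Qed.

Local Notation nijb_mx x := (fun a => \matrix_(c, k) (nij F a c k x)^*).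
Local Notation nij_mx x := (fun a => \matrix_(c, k) nij F a c k x).

Lemma Nb_lowE a b c x :
  Nb_low F a b c x = scale_comp F x * (nij_mx x a *m h x) b c.
Proof.
rewrite /Nb_low mxE mulr_sumr; apply: eq_bigr => k _.
by rewrite /blevi !mxE; ring.
Qed.

Lemma N_lowE a b c x : W x ->
  N_low F a b c x = scale_comp F x * (nijb_mx x a *m (h x)^T) b c.
Proof.
move=> Wx; rewrite /N_low Nb_lowE conjM scale_conj; congr (_ * _).
rewrite !mxE rmorph_sum; apply: eq_bigr => k _.
by rewrite !mxE rmorphM (levi_herm theta_ph c k Wx).
Qed.

Lemma NN1_contract a b x : W x ->
  NN1 F a b x = contract (hi x) (nijb_mx x a *m (h x)^T) (nij_mx x b *m h x).
Proof.
move=> Wx; have s0 := scale_neq0 Wx; do 4!apply: eq_bigr => ? _.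
by rewrite N_lowE // Nb_lowE !blevi_invE //; field.
Qed.

Lemma NN2_contract a b x : W x ->
  NN2 F a b x = contract (hi x) (\matrix_(c, d) (nijb_mx x c *m (h x)^T) d a)
                                (\matrix_(c, d) (nij_mx x c *m h x) d b).
Proof.
move=> Wx; have s0 := scale_neq0 Wx; do 4!apply: eq_bigr => ? _.
rewrite N_lowE // Nb_lowE !blevi_invE //.
rewrite [(\matrix_(c, d) (nijb_mx x c *m _) d a) _ _]mxE.
rewrite [(\matrix_(c, d) (nij_mx x c *m _) d b) _ _]mxE.
by field.
Qed.

Lemma RicE a b x : W x -> Ric F a b x = \sum_c \sum_d hi x d c *
  \sum_k curvature_form Gam a k (e c) (eb d) x * h x k b.
Proof.
move=> Wx; have s0 := scale_neq0 Wx; rewrite /Ric /Ric_mix.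
under eq_bigr => k _ do rewrite mulr_suml.
rewrite exchange_big; apply: eq_bigr => c _.
under eq_bigr => k _ do rewrite mulr_suml.
rewrite exchange_big; apply: eq_bigr => d _; rewrite mulr_sumr.
apply: eq_bigr => k _; rewrite curvE // blevi_invE // /blevi mxE; field.
exact: s0.
Qed.

(** R_(a bar b d bar c) is the conjugate of R_(b bar a c bar d): this is
[levi_curvature] with the conjugate curvature form rewritten through
[curvature_form_conj]. *)
Lemma curvature_herm a b d c x : W x ->
  \sum_k curvature_form Gam d k (e a) (eb b) x * h x k c
  = (\sum_k curvature_form Gam c k (e b) (eb a) x * h x k d)^*.
Proof.
move=> Wx; have vE k : vfield W (e k) := vfield_fr k.
have vEb k : vfield W (eb k) := vfield_frb k.
have /eqP := levi_curvature d c Wx (vE a) (vEb b).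
rewrite addr_eq0 => /eqP ->; rewrite -sumrN rmorph_sum; apply: eq_bigr => k _.
rewrite curvature_form_conj.
have -> : fconj (eb b) = e b by exact: fconjK.
rewrite (curvature_form_anti c k oW (gam_form F) (vE b) (vEb a) Wx).
by rewrite rmorphN mulNr opprK rmorphM (levi_herm theta_ph d k Wx).
Qed.

(** The trace exchange for the Webster curvature; the relation on barred indices
is the conjugate of [bianchi] through [curvature_herm]. *)
Lemma curvature_trace a b x : W x ->
  \sum_c curvature_form Gam c c (e a) (eb b) x
  = Ric F a b x + NN1 F a b x - NN2 F a b x.
Proof.
move=> Wx; have hU := levi_unit theta_ph Wx.
have low2 p q r : (nij_mx x p *m h x) q r = \sum_k nij F p q k x * h x k r.
  by rewrite mxE; apply: eq_bigr => k _; rewrite mxE.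
have low1 p q r : (nijb_mx x p *m (h x)^T) q r = ((nij_mx x p *m h x) q r)^*.
  rewrite low2 mxE rmorph_sum; apply: eq_bigr => k _.
  by rewrite !mxE rmorphM (levi_herm theta_ph r k Wx).
have sk2 p q r : (nij_mx x p *m h x) q r = - (nij_mx x q *m h x) p r.
  rewrite !low2 -sumrN; apply: eq_bigr => k _.
  by rewrite (nij_skew p q k Wx) mulNr.
have cy2 p q r : (nij_mx x p *m h x) q r + (nij_mx x q *m h x) r p
    + (nij_mx x r *m h x) p q = 0.
  by rewrite !low2 -[RHS](nij_cyclic p q r Wx) !big_split.
have B1 p q r s : curvature_form Gam r s (e p) (eb q) x
    - curvature_form Gam p s (e r) (eb q) x
    = - \sum_k nijb_mx x p r k * nij_mx x k q s.
  rewrite (bianchi theta_ph) //; congr (- _); apply: eq_bigr => k _.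
  by rewrite !mxE.
rewrite RicE // NN1_contract // NN2_contract //.
apply: (trace_curvature_exchange
  (Om := fun a b d c => curvature_form Gam d c (e a) (eb b) x)).
- exact: mulmxV.
- by move=> p q r; rewrite !low1 sk2 rmorphN.
- by move=> p q r; rewrite !low1 -!rmorphD cy2 rmorph0.
- exact: sk2.
- exact: cy2.
- by move=> p q r s; exact: B1.
- move=> p q r s; rewrite !(curvature_herm p) // -rmorphB -sumrB.
  under eq_bigr => k _ do rewrite -mulrBl B1 mulNr mulr_suml.
  rewrite sumrN exchange_big rmorphN rmorph_sum; congr (- _).
  apply: eq_bigr => k _; rewrite low1 low2 !mxE.
  transitivity (conjc (conjc (nij F q s k x) * \sum_l nij F k p l x * h x l r)).
    apply: (congr1 conjc); rewrite mulr_sumr.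
    by apply: eq_bigr => l _; rewrite !mxE mulrA.
  by rewrite conjM conjcK.
Qed.

End WebsterCurvature.

(** * Densities of weight (1,0) and their norms *)

Section WebsterDensities.
Context (R : realType) (m : nat) (m_gt0 : (0 < m)%N).
Context (M : almostCR R m) (E : canonical_root M).
Context (theta : covector M) (theta_ph : pseudo_hermitian theta).
Context (F : webster E theta).
Local Notation W := (wdom F).
Local Notation T := (reeb F).
Local Notation e := (fr F).
Local Notation eb := (fun a => fconj (fr F a)).
Local Notation Gam := (gam F).
Implicit Types (a b c d : 'I_m) (x : M) (X Y Z : vecfield M) (f u g : M -> R[i]).

Let oW : open W := wdom_open F.
Let vE a : vfield W (e a). Proof. exact: vfield_fr. Qed.
Let vEb a : vfield W (eb a). Proof. exact: vfield_frb. Qed.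

Lemma dconn10E x v :
  dconn F 1 0 x v = (m.+2)%:R^-1 * \sum_c Gam c c x v.
Proof. by rewrite /dconn mul1r mul0r addr0. Qed.

(** The connection form of E(1,1) is that of E(1,0) plus its conjugate, since
E(1,1) is generated by the norms of sections of E(1,0). *)
Lemma dconn11E x v :
  dconn F 1 1 x v = dconn F 1 0 x v + conjc (dconn F 1 0 x (tconj v)).
Proof.
rewrite !dconn10E conjM /dconn !mul1r mulrDr; congr (_ + _ * _).
  by rewrite -[RHS]/(Num.conj _) fmorphV rmorph_nat.
by rewrite conj_sum.
Qed.

Lemma dconn11_tconj x v : dconn F 1 1 x (tconj v) = conjc (dconn F 1 1 x v).
Proof.
by rewrite !dconn11E tconjK conjD conjcK addrC.
Qed.

Lemma dconn10_form : one_form W (dconn F 1 0).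
Proof.
split=> [x Wx c v w tv tw|V X oV VW vX x Vx].
  rewrite !dconn10E mulrCA -mulrDr; congr (_ * _).
  rewrite mulr_sumr -big_split; apply: eq_bigr => k _.
  by rewrite (form_tlin _ (gam_form F k k) Wx).
have -> : (fun y => dconn F 1 0 y (X y))
    = (fun y => (m.+2)%:R^-1 * \sum_c Gam c c y (X y)).
  by apply/funext => y; rewrite dconn10E.
apply: smoothM; first exact: smooth_cst.
by apply: smooth_sum => k; case: (gam_form F k k) => _ H; exact: (H V X).
Qed.

Lemma dconn10_smooth X x : vfield W X -> W x ->
  smooth_at x (fun y => dconn F 1 0 y (X y)).
Proof. by move=> vX Wx; exact: form_smooth oW _ X x dconn10_form vX Wx. Qed.

(** The quadratic part of the curvature is a commutator of matrices, hence
trace-free. *)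
Lemma curvature_dconn X Y x : vfield W X -> vfield W Y -> W x ->
  (m.+2)%:R^-1 * \sum_c curvature_form Gam c c X Y x
  = dform (dconn F 1 0) X Y x.
Proof.
move=> vX vY Wx; rewrite /curvature_form big_split /=.
have -> : \sum_c \sum_k wedge (Gam k c) (Gam c k) X Y x = 0.
  rewrite /wedge; under eq_bigr => c _ do rewrite sumrB.
  rewrite sumrB [X in X - _]exchange_big; apply/eqP; rewrite subr_eq0; apply/eqP.
  by apply: eq_bigr => c _; apply: eq_bigr => k _; rewrite mulrC.
rewrite addr0 /dform dconn10E.
have D Z Z' : vfield W Z -> vfield W Z' -> Z x (fun y => dconn F 1 0 y (Z' y))
    = (m.+2)%:R^-1 * \sum_c Z x (fun y => Gam c c y (Z' y)).
  move=> vZ vZ'; have tZ := vfield_tan vZ Wx.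
  have s c : smooth_at x (fun y => Gam c c y (Z' y)) by exact: gam_smooth.
  rewrite -(tan_sum _ tZ s) -(tanZ _ tZ (smooth_sum _ s)).
  by congr (Z x _); apply/funext => y; rewrite dconn10E.
by rewrite !D // !sumrB; ring.
Qed.

Lemma nab0_smooth X f x : vfield W X -> W x -> smooth_at x f ->
  smooth_at x (nab0 F 1 0 X f).
Proof.
move=> vX Wx sf; apply: smoothD; first exact: vfield_smooth vX Wx sf.
by apply: smoothM => //; exact: dconn10_smooth.
Qed.

(** The Leibniz rule for E(1,0) times its conjugate. *)
Lemma nab0_mul_conj X u f x : vfield W X -> W x ->
  smooth_at x u -> smooth_at x f ->
  nab0 F 1 1 X (fun y => u y * conjc (f y)) x =
  nab0 F 1 0 X u x * conjc (f x) + u x * conjc (nab0 F 1 0 (fconj X) f x).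
Proof.
move=> vX Wx su sf; rewrite /nab0 dconn11E.
rewrite (tanM (vfield_tan vX Wx) su (smooth_conj sf)).
have -> : conjc (fconj X x f + dconn F 1 0 x (fconj X x) * f x)
  = X x (fun y => conjc (f y)) + conjc (dconn F 1 0 x (tconj (X x))) * conjc (f x).
  rewrite -conjM conjD; congr (_ + _).
  exact: conjcK.
by ring.
Qed.

(** As the barred derivative of [f] vanishes on an open set, so do its further
derivatives, and the mixed second derivative is minus a commutator.  The
bracket of [e a] and the conjugate of [e b] has a Reeb component, whence the
Levi term. *)
Lemma hessb_holomorphic f a b x : W x -> (forall y, W y -> smooth_at y f) ->
  (forall c y, W y -> nab0 F 1 0 (eb c) f y = 0) ->
  nab1 F 1 0 (eb b) (fun a' => nab0 F 1 0 (e a') f) a x =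
  - ((m.+2)%:R^-1 * \sum_c curvature_form Gam c c (e a) (eb b) x) * f x
  + 'i * levi F x a b * nab0 F 1 0 T f x.
Proof.
move=> Wx sf f0; have sx := sf x Wx.
have tE k : tangent x (e k x) := vfield_tan (vE k) Wx.
have tEb k : tangent x (fconj (e k) x) := vfield_tan (vEb k) Wx.
pose om X y := dconn F 1 0 y (X y).
have som X : vfield W X -> smooth_at x (om X) by move=> vX; exact: dconn10_smooth.
have ebf c y : W y -> fconj (e c) y f = - (om (eb c) y * f y).
  by move=> /(f0 c y)/eqP; rewrite addr_eq0 => /eqP.
(* The hypothesis on f, solved for the derivation: eb b acts on f as - om (eb b). *)
have H1 : e a x (fun y => fconj (e b) y f) =
    - (e a x (om (eb b)) * f x + om (eb b) x * e a x f).
  rewrite (tan_eq_on (tE a) oW Wx (fun y Wy => ebf b y Wy)).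
  rewrite (tanN (tE a)); last exact: smoothM (som _ (vEb b)) sx.
  by rewrite (tanM (tE a) (som _ (vEb b)) sx).
have tB := tangent_bracket (vE a) (vEb b) Wx.
have H2 := frame_span Wx tB f.
have H3 := form_span dconn10_form Wx tB.
rewrite (theta_bracket_fr_frb theta_ph) // in H2 H3.
have S (G : functional M -> R[i]) :
    \sum_k cofr F k x (bracket (e a) (eb b) x) * G (e k x)
    = - \sum_k Gam a k x (fconj (e b) x) * G (e k x).
  rewrite -sumrN; apply: eq_bigr => k _.
  by rewrite (cofr_bracket_fr_frb theta_ph) // mulNr.
have Sb (G : functional M -> R[i]) :
    \sum_k form_conj (cofr F k) x (bracket (e a) (eb b) x) * G (fconj (e k) x)
    = \sum_k form_conj (Gam b k) x (e a x) * G (fconj (e k) x).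
  by apply: eq_bigr => k _; rewrite (cofrb_bracket_fr_frb theta_ph).
rewrite (S (fun v => v f)) (Sb (fun v => v f)) in H2.
rewrite (S (dconn F 1 0 x)) (Sb (dconn F 1 0 x)) in H3.
have Sf : \sum_k form_conj (Gam b k) x (e a x) * fconj (e k) x f
   = - (\sum_k form_conj (Gam b k) x (e a x) * dconn F 1 0 x (fconj (e k) x)) * f x.
  rewrite mulNr mulr_suml -sumrN; apply: eq_bigr => k _.
  by rewrite ebf // mulrN mulrA.
rewrite Sf bracketE // H1 in H2.
rewrite (curvature_dconn (vE a) (vEb b) Wx) /dform H3 /nab1.
have -> : \sum_k Gam a k x (fconj (e b) x) * nab0 F 1 0 (e k) f x
   = \sum_k Gam a k x (fconj (e b) x) * e k x f
   + (\sum_k Gam a k x (fconj (e b) x) * dconn F 1 0 x (e k x)) * f x.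
  rewrite mulr_suml -big_split; apply: eq_bigr => k _.
  by rewrite /nab0 mulrDr mulrA.
have -> : nab0 F 1 0 (eb b) (nab0 F 1 0 (e a) f) x =
    fconj (e b) x (fun y => e a y f) + fconj (e b) x (om (e a)) * f x
    + om (e a) x * fconj (e b) x f
    + om (eb b) x * (e a x f + om (e a) x * f x).
  rewrite {1}/nab0; congr (_ + _).
  rewrite /nab0 (tanD (tEb b)); last 2 first.
  - exact: vfield_smooth (vE a) Wx sx.
  - exact: smoothM (som _ (vE a)) sx.
  by rewrite (tanM (tEb b) (som _ (vE a)) sx) addrA.
have -> : fconj (e b) x (fun y => e a y f) =
   - (e a x (om (eb b)) * f x + om (eb b) x * e a x f)
   - (- (e a x (om (eb b)) * f x + om (eb b) x * e a x f)
      - fconj (e b) x (fun y => e a y f)) by ring.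
rewrite H2 ebf // /nab0 -/(om _); ring.
Qed.

Section Norm.
Context (sigma s : density E).
Local Notation f := (Defs.comp F sigma).
Local Notation g := (Defs.comp F s).
Hypothesis f_smooth : forall x, W x -> smooth_at x f.
Hypothesis f_neq0 : forall x, W x -> f x != 0.
Hypothesis g_norm : forall x, W x -> g x = f x * conjc (f x).
Hypothesis f_i : eqn_i F sigma.

(** Used for [v] equal to [f] or to its derivatives, [u] being only known on the
open domain of the frame. *)
Lemma nab0_norm X u v k x : vfield W X -> W x ->
  (forall y, W y -> smooth_at y v) ->
  (forall y, W y -> u y = v y * conjc (f y)) ->
  nab0 F 1 0 (fconj X) f x = k ->
  nab0 F 1 1 X u x = nab0 F 1 0 X v x * conjc (f x) + v x * conjc k.
Proof.
move=> vX Wx sv uv <-; rewrite -nab0_mul_conj //; last 2 first.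
- exact: sv.
- exact: f_smooth.
by rewrite /nab0 (tan_eq_on (vfield_tan vX Wx) oW Wx uv) uv.
Qed.

Lemma nab_norm a x : W x ->
  nab0 F 1 1 (e a) g x = nab0 F 1 0 (e a) f x * conjc (f x).
Proof.
move=> Wx; rewrite (nab0_norm (vE a) Wx f_smooth g_norm (f_i a Wx)).
by rewrite conjc0 mulr0 addr0.
Qed.

Lemma nabb_norm a x : W x ->
  nab0 F 1 1 (eb a) g x = f x * conjc (nab0 F 1 0 (e a) f x).
Proof.
move=> Wx; rewrite (nab0_norm (vEb a) Wx f_smooth g_norm erefl).
by rewrite (f_i a Wx) mul0r add0r fconjK.
Qed.

Lemma nab_smooth a x : W x -> smooth_at x (nab0 F 1 0 (e a) f).
Proof. by move=> Wx; apply: nab0_smooth => //; exact: f_smooth. Qed.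

Lemma hess_norm a b x : W x ->
  hess F 1 1 s a b x = hess F 1 0 sigma a b x * conjc (f x).
Proof.
move=> Wx; rewrite /hess /nab1 mulrBl mulr_suml.
rewrite (nab0_norm (vE a) Wx (nab_smooth b) (nab_norm b) (f_i a Wx)).
rewrite conjc0 mulr0 addr0; congr (_ - _); apply: eq_bigr => k _.
by rewrite nab_norm // mulrA.
Qed.

Lemma hessb_norm a b x : W x ->
  hessb F 1 1 s b a x = hessb F 1 0 sigma b a x * conjc (f x)
    + nab0 F 1 0 (e a) f x * conjc (nab0 F 1 0 (e b) f x).
Proof.
move=> Wx; rewrite /hessb /nab1 mulrBl mulr_suml.
rewrite (nab0_norm (vEb b) Wx (nab_smooth a) (nab_norm a) erefl) fconjK.
rewrite addrAC; congr (_ - _ + _); apply: eq_bigr => k _.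
by rewrite nab_norm // mulrA.
Qed.

Lemma blevi_inv_conj c d x : W x ->
  conjc (blevi_inv F x c d) = blevi_inv F x d c.
Proof.
move=> Wx; rewrite !(blevi_invE theta_ph) // conjM; congr (_ * _).
  by rewrite -[LHS]/(Num.conj _) fmorphV /= [X in X^-1]scale_conj.
have -> : conjc (invmx (levi F x) d c) = map_mx Num.conj (invmx (levi F x)) d c.
  by rewrite mxE.
rewrite map_invmx; have -> : map_mx Num.conj (levi F x) = (levi F x)^T.
  by apply/matrixP => i j; rewrite !mxE (levi_herm theta_ph j i Wx).
by rewrite -trmx_inv mxE.
Qed.

Lemma gradN_norm a b x : W x ->
  gradN F s a b x = f x * conjc (gradNb F sigma a b x).
Proof.
move=> Wx; rewrite /gradN /gradNb exchange_big conj_sum mulr_sumr.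
apply: eq_bigr => c _; rewrite conj_sum mulr_sumr; apply: eq_bigr => d _.
by rewrite nabb_norm // !conjM blevi_inv_conj // /N_low; ring.
Qed.

Lemma divN_conj a b x : W x -> divN F a b x = conjc (divNb F a b x).
Proof.
move=> Wx; rewrite /divN /divNb exchange_big conj_sum; apply: eq_bigr => c _.
rewrite conj_sum; apply: eq_bigr => d _.
rewrite conjM blevi_inv_conj //; congr (_ * _).
rewrite /nab3 conjB conj_sum; congr (_ - _).
  by rewrite /nab0 conjD conjM -dconn11_tconj; congr (_ + _); exact: tconj_app.
by apply: eq_bigr => k _; rewrite !conjD !conjM !conjcK.
Qed.

Lemma sym2_scale (S S' : 'I_m -> 'I_m -> M -> R[i]) k a b x :
  (forall c d, S c d x = k * S' c d x) -> sym2 S a b x = k * sym2 S' a b x.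
Proof. by move=> SS; rewrite /sym2 !SS; ring. Qed.

Lemma sym2_conj (S S' : 'I_m -> 'I_m -> M -> R[i]) a b x :
  (forall c d, S c d x = conjc (S' c d x)) ->
  sym2 S a b x = conjc (sym2 S' a b x).
Proof.
move=> SS; rewrite /sym2 !SS conjM conjD; congr (_ * _).
by rewrite -[RHS]/(Num.conj _) fmorphV rmorph_nat.
Qed.

(** The trace-free part kills multiples of the Levi form, whose trace is [m]. *)
Lemma tracefree_affine (S S' : 'I_m -> 'I_m -> M -> R[i]) k l a b x : W x ->
  (forall c d, S c d x = k * S' c d x + l * blevi F x c d) ->
  tracefree F S a b x = k * tracefree F S' a b x.
Proof.
move=> Wx SS; rewrite /tracefree SS.
have s0 := scale_neq0 theta_ph Wx.
have u : blevi F x \in unitmx by rewrite unitmxZ ?unitfE // (levi_unit theta_ph).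
have tr : \sum_c \sum_d blevi_inv F x c d * blevi F x c d = m%:R.
  rewrite -(mxtrace1 _ m) -(mulmxV u); apply: eq_bigr => c _; rewrite mxE.
  by apply: eq_bigr => d _; rewrite mulrC.
have -> : \sum_c \sum_d blevi_inv F x c d * S c d x
   = k * (\sum_c \sum_d blevi_inv F x c d * S' c d x) + l * m%:R.
  rewrite -tr !mulr_sumr -big_split /=; apply: eq_bigr => c _.
  rewrite !mulr_sumr -big_split /=; apply: eq_bigr => d _.
  by rewrite SS; ring.
have m0 : m%:R != 0 :> R[i] by rewrite pnatr_eq0 -lt0n.
by field.
Qed.

Lemma eqn_E2_iff : eqn_E2 F s <-> eqn_iii F sigma.
Proof.
have key a b x : W x ->
    sym2 (gradN F s) a b x - m%:R^-1 * sym2 (divN F) a b x * g x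
  = f x * conjc (sym2 (gradNb F sigma) a b x
                 - m%:R^-1 * sym2 (divNb F) a b x * f x).
  move=> Wx; rewrite (sym2_scale (S' := fun a b x => conjc (gradNb F sigma a b x))
    _ _ (fun c d => gradN_norm c d Wx)).
  rewrite (sym2_conj (S' := gradNb F sigma)) //.
  rewrite (sym2_conj _ _ (fun c d => divN_conj c d Wx)) g_norm //.
  rewrite conjB !conjM; have -> : conjc (m%:R^-1) = m%:R^-1 :> R[i].
    by rewrite -[LHS]/(Num.conj _) fmorphV rmorph_nat.
  by ring.
split=> H a b x Wx; last by rewrite key // H // conjc0 mulr0.
have /eqP := H a b x Wx; rewrite key // mulf_eq0 (negPf (f_neq0 Wx)) /=.
by rewrite conjc_eq0 => /eqP.
Qed.

(** The second equation trades the gradient term for the divergence of N; what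
remains is (ii) times the conjugate of [f]. *)
Lemma eqn_E1_iff : eqn_E2 F s -> (eqn_E1 F s <-> eqn_ii F sigma).
Proof.
move=> E2; have key a b x : W x ->
    sym2 (hess F 1 1 s) a b x + 'i * A_low F a b x * g x
    + sym2 (gradN F s) a b x
  = conjc (f x) * (sym2 (hess F 1 0 sigma) a b x + 'i * A_low F a b x * f x
    + m%:R^-1 * sym2 (divN F) a b x * f x).
  move=> Wx; have /eqP := E2 a b x Wx; rewrite subr_eq0 => /eqP ->.
  rewrite (sym2_scale (S' := hess F 1 0 sigma) (k := conjc (f x))) => [|c d].
    by rewrite g_norm //; ring.
  by rewrite hess_norm // mulrC.
split=> H a b x Wx; last by rewrite key // H // mulr0.
have /eqP := H a b x Wx; rewrite key // mulf_eq0 conjc_eq0 (negPf (f_neq0 Wx)) /=.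
by move/eqP.
Qed.

(** The mixed gradients of [s] cancel, the trace of the curvature in the mixed
Hessian cancels the Ricci tensor of the Schouten tensor by
[curvature_trace], and the remaining terms other than (iv) are multiples of the
Levi form. *)
Lemma eqn_E3_iff : eqn_E3 F s <-> eqn_iv F.
Proof.
have key a b x (Wx : W x) := @tracefree_affine
  (fun a b x => g x * hessb F 1 1 s b a x
    - nab0 F 1 1 (e a) g x * nab0 F 1 1 (eb b) g x
    + Pten F a b x * g x ^+ 2 - (m.+2)%:R^-1 * NN1 F a b x * g x ^+ 2)
  (fun a b x => 2%:R * NN1 F a b x - NN2 F a b x)
  (- ((m.+2)%:R^-1 * g x ^+ 2))
  (g x * conjc (f x) * 'i * (scale_comp F x)^-1 * nab0 F 1 0 T f x
    - (m.+2)%:R^-1 * (m.*2.+2)%:R^-1 * Sc F x * g x ^+ 2) a b x Wx.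
have {}key a b x : W x -> tracefree F (fun a b x => g x * hessb F 1 1 s b a x
    - nab0 F 1 1 (e a) g x * nab0 F 1 1 (eb b) g x
    + Pten F a b x * g x ^+ 2 - (m.+2)%:R^-1 * NN1 F a b x * g x ^+ 2) a b x
  = - ((m.+2)%:R^-1 * g x ^+ 2)
    * tracefree F (fun a b x => 2%:R * NN1 F a b x - NN2 F a b x) a b x.
  move=> Wx; apply: (key a b x Wx) => c d; have s0 := scale_neq0 theta_ph Wx.
  rewrite hessb_norm // nab_norm // nabb_norm //.
  rewrite {1}/hessb (hessb_holomorphic c d Wx f_smooth f_i).
  rewrite (curvature_trace theta_ph) // /Pten /blevi mxE !g_norm //.
  have m2 : (m.+2)%:R != 0 :> R[i] by rewrite pnatr_eq0.
  have m22 : (m.*2.+2)%:R != 0 :> R[i] by rewrite pnatr_eq0.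
  move: s0 m2 m22; move: (m.+2)%:R (m.*2.+2)%:R => k1 k2 s0 m2 m22.
  by field; rewrite s0 m2 m22.
split=> H a b x Wx; last by rewrite key // H // mulr0.
have /eqP := H a b x Wx; rewrite key // mulf_eq0 oppr_eq0 mulf_eq0 invr_eq0.
rewrite pnatr_eq0 /= sqrf_eq0 g_norm // mulf_eq0 conjc_eq0 (negPf (f_neq0 Wx)) /=.
by move/eqP.
Qed.

End Norm.
End WebsterDensities.

Lemma sqnorm_CR_scale (R : realType) (m : nat) (M : almostCR R m)
    (E : canonical_root M) (sigma : density E) :
  density_of 1 0 sigma -> nowhere_vanishing sigma -> CR_scale (sqnorm sigma).
Proof.
move=> [hom sm] nv; split; last first.
  by move=> x t t0; rewrite /sqnorm mul_conjC_gt0; apply/eqP; exact: nv.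
split=> [x t c t0 c0|U t oU ft x Ux].
  rewrite /sqnorm hom // oppr0 expr0z mulr1 !exprN1 rmorphM fmorphV /=.
  by rewrite !mulrA; congr (_ * _); rewrite mulrAC.
by apply: smoothM; [|apply: smooth_conj]; exact: (sm U).
Qed.

Lemma comp_smooth (R : realType) (m : nat) (M : almostCR R m)
    (E : canonical_root M) (theta : covector M) (F : webster E theta) w w'
    (sigma : density E) x :
  density_of w w' sigma -> wdom F x -> smooth_at x (Defs.comp F sigma).
Proof. by case=> _ sm Wx; exact: (sm _ _ (wdom_open F) (wtriv_frame F)). Qed.

Theorem theorem2p8 (R : realType) (m : nat) (m_gt0 : (0 < m)%N)
    (M : almostCR R m) (E : canonical_root M)
    (theta : covector M) (theta_ph : pseudo_hermitian theta) :
  (forall sigma : density E,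
     density_of 1 0 sigma -> nowhere_vanishing sigma ->
     system_i theta sigma -> system_ii theta sigma ->
     system_iii theta sigma -> system_iv E theta ->
     CR_Einstein_scale theta (sqnorm sigma)) /\
  (forall s sigma : density E,
     CR_Einstein_scale theta s ->
     density_of 1 0 sigma -> density_eq s (sqnorm sigma) ->
     system_i theta sigma ->
     [/\ system_ii theta sigma, system_iii theta sigma & system_iv E theta]).
Proof.
have W0 (F : webster E theta) x : wdom F x -> wtriv F x <> 0.
  by case: (wtriv_frame F) => + _ => /[apply].
split=> [sigma ds nv i ii iii iv|s sigma [cs Es] ds ss i].
  split=> [|F]; first exact: sqnorm_CR_scale.
  have fs x : wdom F x -> smooth_at x (Defs.comp F sigma) by exact: comp_smooth ds.
  have f0 x : wdom F x -> Defs.comp F sigma x != 0.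
    by move=> Wx; apply/eqP/nv/W0.
  have E2 : eqn_E2 F (sqnorm sigma).
    by apply/(eqn_E2_iff theta_ph fs f0) => //; exact: iii.
  split=> //.
  - by apply/(eqn_E1_iff fs f0) => //; exact: ii.
  - by apply/(eqn_E3_iff m_gt0 theta_ph fs f0) => //; exact: iv.
have fs (F : webster E theta) x :
    wdom F x -> smooth_at x (Defs.comp F sigma) by exact: comp_smooth ds.
have g_norm (F : webster E theta) x : wdom F x -> Defs.comp F s x =
    Defs.comp F sigma x * conjc (Defs.comp F sigma x).
  by move=> Wx; rewrite /Defs.comp (ss x _ (W0 F x Wx)).
have f0 (F : webster E theta) x : wdom F x -> Defs.comp F sigma x != 0.
  move=> Wx; have [_ /(_ x _ (W0 F x Wx)) pos] := cs; apply/eqP => fx.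
  by have := g_norm F x Wx; rewrite fx mul0r => gx; move: pos;
  rewrite -[s x _]/(Defs.comp F s x) gx ltxx.
split=> F; have [E1 E2 E3] := Es F.
- exact/(eqn_E1_iff (fs F) (f0 F) (g_norm F) (i F) E2).
- exact/(eqn_E2_iff theta_ph (fs F) (f0 F) (g_norm F) (i F)).
- exact/(eqn_E3_iff m_gt0 theta_ph (fs F) (f0 F) (g_norm F) (i F)).
Qed.
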